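(* (i) For every $n\ge 1$, the incompatibility robustness of the degree-2 Majorana observables satisfies $\eta_2^*\le \frac{1}{\sqrt{2n-1}}$, with equality if and only if there exists a real $2n\times 2n$ skew-Hadamard matrix. Moreover $\eta_2^*=\Theta(n^{-1/2})$ as $n\to\infty$. (ii) For every fixed integer $1\le k\le 5$ and all sufficiently large $n$, $\eta_{2k}^*\le \sqrt{\binom{n}{k}\big/\binom{2n}{2k}}$. Moreover $\eta_{2k}^*=\Theta(n^{-k/2})$ as $n\to\infty$.
   Context: Let $\gamma_1,\dots,\gamma_{2n}$ be Majorana operators on $(\mathbb C^2)^{\otimes n}$ (Hermitian, $\gamma_j\gamma_{j'}+\gamma_{j'}\gamma_j=2\delta_{jj'}I$). For $S=\{j_1<\dots<j_m\}\subseteq[2n]$, $\gamma_S=i^{\binom m2}\gamma_{j_1}\cdots\gamma_{j_m}$, and $\mathcal S_m=\{S\subseteq[2n]:|S|=m\}$. For $\eta\in[0,1]$ let $\mathsf M^\eta_S(\pm)=\frac12(I\pm\eta\gamma_S)$. A finite family of POVMs $\mathsf M_j$ is jointly measurable (compatible) if there exist a POVM $\mathsf G$ on a finite set $\Lambda$ and stochastic maps $D(e|j,\lambda)\ge0$, $\sum_eD(e|j,\lambda)=1$, with $\mathsf M_j(e)=\sum_\lambda D(e|j,\lambda)\mathsf G(\lambda)$. The incompatibility robustness is $\eta_m^*=\sup\{\eta\in[0,1]:\{\mathsf M^\eta_S\}_{S\in\mathcal S_m}\text{ is jointly measurable}\}$. A real $m\times m$ Hadamard matrix is a matrix $H$ with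 entries $\pm1$ and $HH^T=mI$; it is skew-Hadamard if moreover $H+H^T=2I$. *)

(* Defs.v *)
From HB Require Import structures.
From mathcomp Require Import all_boot all_order all_algebra.
From mathcomp Require Import complex.
From mathcomp Require Import classical_sets reals.
Set Implicit Arguments. Unset Strict Implicit. Unset Printing Implicit Defensive.
Import Order.TTheory GRing.Theory Num.Theory.
Local Open Scope ring_scope.
Local Open Scope complex_scope.

Section Defs.
Variable R : realType.
Local Notation C := R[i].

Definition adjmx m p (A : 'M[C]_(m, p)) : 'M[C]_(p, m) := (map_mx Num.conj A)^T.

Definition hermitian d (A : 'M[C]_d) : Prop := adjmx A = A.

Definition psd d (A : 'M[C]_d) : Prop :=
  hermitian A /\ forall v : 'rV[C]_d, 0 <= (v *m A *m adjmx v) 0 0.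

(* gamma_1, ..., gamma_{2n} (indexed by 'I_(2n)) on (C^2)^{\otimes n} = C^{2^n} *)
Definition is_majorana n (g : 'I_(2 * n) -> 'M[C]_(2 ^ n)) : Prop :=
  (forall j, hermitian (g j)) /\
  (forall j j', g j *m g j' + g j' *m g j = ((j == j')%:R *+ 2)%:M).

(* gamma_S = i^(binom |S| 2) gamma_{j1} ... gamma_{jm}, j1 < ... < jm
   (enum S lists the elements of S in increasing order) *)
Definition gammaS n (g : 'I_(2 * n) -> 'M[C]_(2 ^ n)) (S : {set 'I_(2 * n)}) :
  'M[C]_(2 ^ n) :=
  ((Complex 0 1) ^+ 'C(#|S|, 2)) *: foldr (fun j A => g j *m A) 1%:M (enum S).

Definition Meff n (g : 'I_(2 * n) -> 'M[C]_(2 ^ n)) (eta : R)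
  (S : {set 'I_(2 * n)}) (b : bool) : 'M[C]_(2 ^ n) :=
  (2%:R)^-1 *: (1%:M + ((if b then 1 else -1) * eta%:C) *: gammaS g S).

Definition is_povm d (L : finType) (G : L -> 'M[C]_d) : Prop :=
  (forall l, psd (G l)) /\ \sum_l G l = 1%:M.

Definition jointly_measurable d (I O : finType) (M : I -> O -> 'M[C]_d) : Prop :=
  exists (L : finType) (G : L -> 'M[C]_d) (D : I -> L -> O -> R),
    is_povm G /\
    (forall i l e, 0 <= D i l e) /\
    (forall i l, \sum_e D i l e = 1) /\
    (forall i e, M i e = \sum_l (D i l e)%:C *: G l).

Definition Sm n m := {S : {set 'I_(2 * n)} | #|S| == m}.

Definition eta_star n (g : 'I_(2 * n) -> 'M[C]_(2 ^ n)) (m : nat) : R :=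
  sup [set eta : R | 0 <= eta <= 1 /\
        jointly_measurable (fun S : Sm n m => Meff g eta (val S))].

End Defs.

Definition hadamard m (H : 'M[int]_m) : Prop :=
  (forall i j, H i j = 1 \/ H i j = -1) /\ H *m H^T = (m%:R)%:M.

Definition skew_hadamard m (H : 'M[int]_m) : Prop :=
  hadamard H /\ H + H^T = 2%:M.

(* Main.v *)
(* Pairing the observables with a joint POVM [G] turns compatibility into a bound on
   sums [\sum_S a_S Re tr(G_l gamma_S)] with [|a_S| <= 1]; conversely, twirling states by all the
   [gamma_T] (an orthogonal basis of the matrices) turns lower bounds on [|tr(rho gamma_S)|] into
   a joint measurement.

   In degree 2 the upper bound is Cauchy-Schwarz applied to the rows of the skew sign matrix [a].
   It is improved by a fixed amount when two rows are not orthogonal, hence strict unless some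
   [a + I] is skew-Hadamard; and a skew-Hadamard matrix is, up to scaling, the covariance
   matrix of a pure Gaussian state, which attains the bound.

   In degree 2k the upper bound is a dual certificate for a Lovasz theta function: a kernel in
   [|S :&: T|] that is a nonnegative combination of the projections onto the odd isotypic
   components of the Johnson scheme.  For the lower bound, the Gaussian states of skew-Hadamard
   matrices of size a power of two have correlations equal to Pfaffians of +-1 matrices, which are
   odd integers, hence nonzero; boundedly many such states cover all S. *)
Require Import Defs.
From HB Require Import structures.
From mathcomp Require Import all_boot all_order all_algebra.
From mathcomp Require Import complex.
From mathcomp Require Import classical_sets reals.
From mathcomp Require Import zify ssrZ ring lra.
From Stdlib Require BinInt.
Import Order.TTheory GRing.Theory Num.Theory.
Local Open Scope ring_scope.
Set Implicit Arguments. Unset Strict Implicit. Unset Printing Implicit Defensive.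

(** * Adjoints, positivity and expectations *)

Section Adjoint.
Variable R : realType.
Local Notation C := R[i].

(** Strictness in degree two has to survive a supremum, so the gain over Cauchy-Schwarz must be
    uniform: the inner product of two rows of a sign matrix is an integer, hence at least 1 in
    absolute value when nonzero, and the resulting gap depends on n alone. For |S| = |T| = 2k the
    operators commute exactly when |S :&: T| is even, so the kernel is prescribed at the k + 1 even
    intersections only: the k weights of the odd components are chosen to give -1 at 0, 2, ..., 2k -
    2, and the value at 2k comes out as 'C(n, k) - 1. The weights are rational functions of n whose
    signs are read off leading coefficients; hence n is taken large, and each k from 1 to 5 has its
    own verified identities. Skew-Hadamard matrices are constructed only in sizes that are powers of
    two. A state of the largest such size M <= 2n controls only M of the 2n generators, which forces
    the use of several states. *)

Lemma adjmxE m p (A : 'M[C]_(m, p)) i j : adjmx A i j = Num.conj (A j i).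
Proof. by rewrite !mxE. Qed.

Lemma adjmxK m p (A : 'M[C]_(m, p)) : adjmx (adjmx A) = A.
Proof. by apply/matrixP => i j; rewrite !adjmxE conjCK. Qed.

Lemma adjmxM m p q (A : 'M[C]_(m, p)) (B : 'M[C]_(p, q)) :
  adjmx (A *m B) = adjmx B *m adjmx A.
Proof. by rewrite /adjmx map_mxM trmx_mul. Qed.

Lemma adjmxD m p (A B : 'M[C]_(m, p)) : adjmx (A + B) = adjmx A + adjmx B.
Proof. by rewrite /adjmx map_mxD linearD. Qed.

Lemma adjmxZ m p (a : C) (A : 'M[C]_(m, p)) : adjmx (a *: A) = Num.conj a *: adjmx A.
Proof. by apply/matrixP => i j; rewrite !mxE rmorphM. Qed.

Lemma adjmx0 m p : adjmx (0 : 'M[C]_(m, p)) = 0.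
Proof. by rewrite /adjmx map_mx0 trmx0. Qed.

Lemma adjmx1 m : adjmx (1%:M : 'M[C]_m) = 1%:M.
Proof. by rewrite /adjmx map_mx1 trmx1. Qed.

Lemma adjmx_sum m p (I : Type) (r : seq I) (P : pred I) (F : I -> 'M[C]_(m, p)) :
  adjmx (\sum_(i <- r | P i) F i) = \sum_(i <- r | P i) adjmx (F i).
Proof. by apply: (big_morph _ (@adjmxD m p)); rewrite adjmx0. Qed.

Lemma mxtrace_adjmx m (A : 'M[C]_m) : \tr (adjmx A) = Num.conj (\tr A).
Proof. by rewrite /adjmx mxtrace_tr /mxtrace rmorph_sum; apply: eq_bigr => i _; rewrite mxE. Qed.

Lemma conj_realC (x : R) : Num.conj x%:C%C = x%:C%C :> C.
Proof. exact: conjc_real. Qed.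

Lemma conj_i : Num.conj (Complex 0 1 : C) = - Complex 0 1.
Proof. by apply/eqP; rewrite eq_complex /= oppr0 !eqxx. Qed.

Lemma i_sqr : (Complex 0 1 : C) * Complex 0 1 = -1.
Proof. by rewrite -[RHS]sqr_i expr2. Qed.

Lemma Re_conj (x : C) : complex.Re (Num.conj x) = complex.Re x.
Proof. by case: x. Qed.

Lemma ReD (x y : C) : complex.Re (x + y) = complex.Re x + complex.Re y.
Proof. by case: x; case: y. Qed.

Lemma ReN (x : C) : complex.Re (- x) = - complex.Re x.
Proof. by case: x. Qed.

Lemma ReZ (a : R) (x : C) : complex.Re (a%:C%C * x) = a * complex.Re x.
Proof. by case: x => u v /=; rewrite mul0r subr0. Qed.

Lemma Re_sum (I : Type) (r : seq I) (P : pred I) (F : I -> C) :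
  complex.Re (\sum_(i <- r | P i) F i) = \sum_(i <- r | P i) complex.Re (F i).
Proof. exact: (big_morph (@complex.Re R) ReD erefl). Qed.

Lemma realC_Re (z : C) : Num.conj z = z -> z = (complex.Re z)%:C%C.
Proof.
case: z => a b /eqP; rewrite eq_complex /= => /andP[_ /eqP hb].
by apply/eqP; rewrite eq_complex /= eqxx; apply/eqP; lra.
Qed.

Lemma natrC (n : nat) : (n%:R : R)%:C%C = n%:R :> C.
Proof. by rewrite rmorph_nat. Qed.

(** Real part, so that all estimates take place in R; for positive G an unnormalized expectation of
    total mass [ev G 1%:M]. *)
Definition ev d (G A : 'M[C]_d) : R := complex.Re (\tr (G *m A)).

Lemma evD d (G A B : 'M[C]_d) : ev G (A + B) = ev G A + ev G B.
Proof. by rewrite /ev mulmxDr mxtraceD ReD. Qed.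

Lemma evN d (G A : 'M[C]_d) : ev G (- A) = - ev G A.
Proof. by rewrite /ev mulmxN raddfN ReN. Qed.

Lemma evZ d (G : 'M[C]_d) (a : R) A : ev G (a%:C%C *: A) = a * ev G A.
Proof. by rewrite /ev -scalemxAr mxtraceZ ReZ. Qed.

Lemma evC d (G : 'M[C]_d) (a : R) : ev G (a%:C%C)%:M = a * ev G 1%:M.
Proof. by rewrite -(scalemx1 _ a%:C%C) evZ. Qed.

Lemma ev_sum d (G : 'M[C]_d) (I : Type) (r : seq I) (P : pred I) (F : I -> 'M[C]_d) :
  ev G (\sum_(i <- r | P i) F i) = \sum_(i <- r | P i) ev G (F i).
Proof. by rewrite /ev mulmx_sumr (raddf_sum (@mxtrace C d)) Re_sum. Qed.

Lemma ev_adjmx d (G A : 'M[C]_d) : Defs.hermitian G -> ev G (adjmx A) = ev G A.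
Proof.
by move=> hG; rewrite /ev -{1}hG -(adjmxM A G) mxtrace_adjmx Re_conj mxtrace_mulC.
Qed.

(** Cyclicity turns the trace into the sum of the quadratic forms of G at the rows of [adjmx Y]. *)
Lemma ev_psd d (G Y : 'M[C]_d) : psd G -> 0 <= ev G (Y *m adjmx Y).
Proof.
case=> _ hG; rewrite /ev mulmxA mxtrace_mulC mulmxA /mxtrace Re_sum.
apply: sumr_ge0 => i _; have := hG (row i (adjmx Y)).
have -> : (row i (adjmx Y) *m G *m adjmx (row i (adjmx Y))) 0 0 = (adjmx Y *m G *m Y) i i.
  rewrite -row_mul mxE [RHS]mxE; apply: eq_bigr => k _.
  by rewrite [row _ _ _ _]mxE adjmxE [row i (adjmx Y) _ _]mxE adjmxE conjCK.
by rewrite lecE => /andP[].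
Qed.

Lemma psd_conj d (G Y : 'M[C]_d) : psd G -> psd (Y *m G *m adjmx Y).
Proof.
case=> hG pG; split; first by rewrite /Defs.hermitian !adjmxM adjmxK hG mulmxA.
by move=> v; have := pG (v *m Y); rewrite adjmxM !mulmxA.
Qed.

Lemma psdZ d (a : R) (G : 'M[C]_d) : 0 <= a -> psd G -> psd (a%:C%C *: G).
Proof.
move=> a0 [hG pG]; split; first by rewrite /Defs.hermitian adjmxZ conj_realC hG.
by move=> v; rewrite -scalemxAr -scalemxAl mxE mulr_ge0 // lecR.
Qed.

Lemma psd_rank1 d (v : 'rV[C]_d) : psd (adjmx v *m v).
Proof.
split; first by rewrite /Defs.hermitian adjmxM adjmxK.
move=> w; rewrite mulmxA -mulmxA.
set a := w *m adjmx v; have -> : v *m adjmx w = adjmx a by rewrite adjmxM adjmxK.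
by rewrite mxE big_ord1 adjmxE mul_conjC_ge0.
Qed.

End Adjoint.

(** * Products of Majorana operators *)

Section Majorana.
Variables (R : realType) (N d : nat) (g : 'I_N -> 'M[R[i]]_d).
Local Notation C := R[i].
Local Notation I1 := (Complex 0 1 : C).

Definition gprod (s : seq 'I_N) : 'M[C]_d := foldr (fun j A => g j *m A) 1%:M s.

Definition gseq (s : seq 'I_N) : 'M[C]_d := I1 ^+ 'C(size s, 2) *: gprod s.

Fact gset_key : unit. Proof. by []. Qed.
(* Locked, so that matching modulo conversion does not unfold it to a scaled matrix. *)
Definition gset : {set 'I_N} -> 'M[C]_d := locked_with gset_key (fun S => gseq (enum S)).

Lemma gset_seq S : gset S = gseq (enum S).
Proof. by rewrite /gset unlock. Qed.

Lemma gsetE S : gset S = I1 ^+ 'C(#|S|, 2) *: gprod (enum S).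
Proof. by rewrite gset_seq /gseq -cardE. Qed.

(** [is_majorana] with the number of generators and the dimension decoupled: an injectively
    reindexed subfamily on the same space is again an instance, as the lower bounds require. *)
Definition majorana :=
  (forall j, adjmx (g j) = g j) /\
  (forall j j', g j *m g j' + g j' *m g j = ((j == j')%:R *+ 2)%:M).

Hypothesis hg : majorana.

Let gh j : adjmx (g j) = g j. Proof. by case: hg. Qed.
Let gc j j' : g j *m g j' + g j' *m g j = ((j == j')%:R *+ 2)%:M.
Proof. by case: hg. Qed.

Lemma two_neq0 : (2%:R : C) != 0.
Proof. by rewrite pnatr_eq0. Qed.

Lemma g_sqr j : g j *m g j = 1%:M.
Proof.
have := gc j j; rewrite eqxx -mulr2n -[X in _ = (X%:M)]/(2%:R) => h.
apply: (scalerI two_neq0); rewrite scaler_nat h.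
by rewrite scale_scalar_mx mulr1.
Qed.

Lemma g_anti j j' : j != j' -> g j *m g j' = - (g j' *m g j).
Proof.
move=> /negbTE h; apply/eqP; rewrite -subr_eq0 opprK gc h mul0rn.
by rewrite raddf0.
Qed.

Lemma gprod_cat s t : gprod (s ++ t) = gprod s *m gprod t.
Proof. by elim: s => [|x s IH] /=; rewrite ?mul1mx // IH mulmxA. Qed.

(** Each letter of s other than j contributes a sign; letters equal to j commute with [g j], and
    their count corrects the parity. *)
Lemma g_gprod j s :
  g j *m gprod s = (-1) ^+ (size s + count_mem j s) *: (gprod s *m g j).
Proof.
elim: s => [|x s IH] /=; first by rewrite mulmx1 mul1mx scale1r.
have [->|xj] := eqVneq x j.
  by rewrite add1n addnS addSn !exprS !mulN1r opprK -mulmxA scalemxAr -IH.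
rewrite add0n addSn exprS mulN1r scaleNr -mulmxA scalemxAr -IH.
by rewrite mulmxA (g_anti (_ : j != x)) ?mulNmx ?mulmxA // eq_sym.
Qed.

Lemma gprod_comm s t :
  gprod s *m gprod t =
  (-1) ^+ (size s * size t + \sum_(j <- s) count_mem j t) *: (gprod t *m gprod s).
Proof.
elim: s => [|x s IH] /=; first by rewrite big_nil mul1mx mulmx1 scale1r.
rewrite big_cons -mulmxA IH -scalemxAr (mulmxA (g x)) g_gprod -scalemxAl scalerA.
rewrite -exprD -mulmxA; congr (_ *: _); congr (_ ^+ _).
by rewrite mulSn [LHS]addnC addnACA.
Qed.

Lemma adjmx_gprod s : adjmx (gprod s) = gprod (rev s).
Proof.
elim: s => [|x s IH] /=; first by rewrite adjmx1.
by rewrite adjmxM gh IH rev_cons -cats1 gprod_cat /= mulmx1.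
Qed.

Lemma gprod_adj s : gprod s *m adjmx (gprod s) = 1%:M.
Proof.
elim: s => [|x s IH] /=; first by rewrite adjmx1 mulmx1.
by rewrite adjmxM gh -mulmxA [gprod s *m _]mulmxA IH mul1mx g_sqr.
Qed.

Lemma gprod_rev s : uniq s -> gprod (rev s) = (-1) ^+ 'C(size s, 2) *: gprod s.
Proof.
elim: s => [|x s IH] /=; first by rewrite scale1r.
case/andP=> xs us; rewrite rev_cons -cats1 gprod_cat /= mulmx1 IH //.
rewrite -scalemxAl g_gprod (count_memPn xs) addn0 scalerA binS bin1 -exprD.
by rewrite -addnA exprD addnn -(signr_odd _ _.*2) odd_double mulr1.
Qed.

(** Reversing m anticommuting factors costs (-1)^'C(m, 2), and conjugating the phase i^'C(m, 2)
    costs the same sign. *)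
Lemma adjmx_gseq s : uniq s -> adjmx (gseq s) = gseq s.
Proof.
move=> us; rewrite adjmxZ adjmx_gprod gprod_rev // scalerA rmorphXn /= conj_i.
by rewrite -exprMn mulrN1 opprK.
Qed.

Lemma gseq_sqr s : uniq s -> gseq s *m gseq s = 1%:M.
Proof.
move=> us; rewrite -{2}adjmx_gseq // adjmxZ -scalemxAr -scalemxAl scalerA gprod_adj.
by rewrite rmorphXn /= conj_i -exprMn mulNr i_sqr opprK expr1n scale1r.
Qed.

Lemma gseq_comm s t :
  gseq s *m gseq t =
  (-1) ^+ (size s * size t + \sum_(j <- s) count_mem j t) *: (gseq t *m gseq s).
Proof.
rewrite /gseq -!scalemxAr -!scalemxAl gprod_comm !scalerA.
congr (_ *: _); ring.
Qed.

Lemma g_gseq j s : g j *m gseq s = (-1) ^+ (size s + count_mem j s) *: (gseq s *m g j).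
Proof. by rewrite /gseq -scalemxAr g_gprod -!scalemxAl !scalerA mulrC. Qed.

Lemma adjmx_gset S : adjmx (gset S) = gset S.
Proof. by rewrite gset_seq; exact/adjmx_gseq/enum_uniq. Qed.

Lemma gset_sqr S : gset S *m gset S = 1%:M.
Proof. by rewrite gset_seq; exact/gseq_sqr/enum_uniq. Qed.

Lemma gset_comm S T :
  gset S *m gset T = (-1) ^+ (#|S| * #|T| + #|S :&: T|) *: (gset T *m gset S).
Proof.
rewrite !gset_seq gseq_comm -!cardE; congr ((-1) ^+ (_ + _) *: _).
rewrite big_enum /= -sum1_card big_mkcond [RHS]big_mkcond /=.
apply: eq_bigr => j _; rewrite inE count_uniq_mem ?enum_uniq // mem_enum.
by case: (j \in S).
Qed.

Lemma g_gset j S : g j *m gset S = (-1) ^+ (#|S| + (j \in S)) *: (gset S *m g j).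
Proof.
by rewrite gset_seq g_gseq -cardE count_uniq_mem ?enum_uniq // mem_enum.
Qed.

(** Conjugating W by the involution [g j] negates it but preserves its trace. *)
Lemma trace_anti j (W : 'M[C]_d) : g j *m W = - (W *m g j) -> \tr W = 0.
Proof.
move=> h; have e : \tr W = - \tr W.
  rewrite -{1}[W]mul1mx -(g_sqr j) -mulmxA h mulmxN raddfN /=; congr (- _).
  by rewrite mxtrace_mulC -mulmxA g_sqr mulmx1.
apply/eqP; rewrite -(mulrI_eq0 _ (lregP two_neq0)) mulr_natl mulr2n.
by rewrite {1}e addNr.
Qed.

(* A Majorana operator [g j] anticommutes with [gset S *m gset T] exactly
   when j lies in the symmetric difference of S and T (if [#|S| + #|T|] is even) or outside it
   (if odd); such a j exists because N is even. *)
Lemma trace_gset S T : ~~ odd N -> S != T -> \tr (gset S *m gset T) = 0.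
Proof.
move=> oN ST.
suff [j hj] : exists j, odd (#|S| + (j \in S) + (#|T| + (j \in T))).
  apply: (@trace_anti j); rewrite mulmxA g_gset -scalemxAl -mulmxA g_gset.
  by rewrite -scalemxAr mulmxA scalerA -exprD -signr_odd hj expr1 scaleN1r.
pose D := S :\: T :|: T :\: S.
have inD j : (j \in D) = (j \in S) (+) (j \in T).
  by rewrite !inE; case: (j \in S); case: (j \in T).
have par j : odd (#|S| + (j \in S) + (#|T| + (j \in T))) =
    odd #|S| (+) odd #|T| (+) (j \in D).
  by rewrite inD !oddD !oddb addbACA.
have cD : odd #|D| = odd #|S| (+) odd #|T|.
  rewrite cardsU (_ : _ :&: _ = finset.set0) ?cards0 ?subn0; last first.
    by apply/setP => j; rewrite !inE; case: (j \in S); case: (j \in T).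
  rewrite oddD -(cardsID T S) -(cardsID S T) (finset.setIC T S) !oddD.
  by case: (odd _); case: (odd _); case: (odd _).
have [oS|eS] := boolP (odd #|S| (+) odd #|T|).
  have : D != finset.setT.
    by apply: contraTneq oN => e; move: cD; rewrite e cardsT card_ord oS => ->.
  rewrite -properT => /properP[_ [j _ /negbTE jD]].
  by exists j; rewrite par jD oS.
have /set0Pn[j jD] : D != finset.set0.
  apply: contraNneq ST => e; apply/eqP/setP => j.
  by have := inD j; rewrite e inE; case: (j \in S); case: (j \in T).
by exists j; rewrite par jD (negbTE eS).
Qed.

Lemma trace_gset_diag S T : ~~ odd N ->
  \tr (gset S *m gset T) = (S == T)%:R * d%:R.
Proof.
move=> oN; have [<-|ST] := eqVneq S T; last by rewrite trace_gset // mul0r.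
by rewrite gset_sqr mxtrace1 mul1r.
Qed.

End Majorana.

(** * Joint measurability *)

(** A one-sided inverse of a square matrix is two-sided; in this form, orthogonality of a family
    becomes completeness. *)
Lemma finsum_inverse (K : comUnitRingType) (A B : finType) (F : A -> B -> K) (G : B -> A -> K) :
  #|A| = #|B| -> (forall a a', \sum_b F a b * G b a' = (a == a')%:R) ->
  forall b b', \sum_a G b a * F a b' = (b == b')%:R.
Proof.
move=> e h b b'.
pose vB (i : 'I_#|A|) : B := enum_val (cast_ord e i).
pose rB (b : B) : 'I_#|A| := cast_ord (esym e) (enum_rank b).
have vr c : vB (rB c) = c by rewrite /vB /rB cast_ordKV enum_rankK.
have rv i : rB (vB i) = i by rewrite /vB /rB enum_valK cast_ordK.
pose MF := \matrix_(i < #|A|, j < #|A|) F (enum_val i) (vB j).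
pose MG := \matrix_(i < #|A|, j < #|A|) G (vB i) (enum_val j).
have FG : MF *m MG = 1%:M.
  apply/matrixP => i j; rewrite !mxE -(inj_eq enum_val_inj) -h.
  rewrite [RHS](reindex vB) /=; last by exists rB => x _.
  by apply: eq_bigr => k _; rewrite !mxE.
have /matrixP/(_ (rB b) (rB b')) := mulmx1C FG.
rewrite !mxE (inj_eq (can_inj vr)) => <-.
rewrite (reindex (fun i : 'I_#|A| => enum_val i : A)) /=; last first.
  by exists enum_rank => x _; rewrite ?enum_valK ?enum_rankK.
by apply: eq_bigr => k _; rewrite !mxE !vr.
Qed.

Lemma mxM (K : pzSemiRingType) m n p (A : 'M[K]_(m, n)) (B : 'M[K]_(n, p)) i j :
  (A *m B) i j = \sum_k A i k * B k j.
Proof. by rewrite mxE. Qed.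

Section Measurability.
Variable R : realType.
Local Notation C := R[i].

(** The operators [gset g T] are orthogonal for the trace form and there are d^2 of them, so they
    form a basis; their completeness relation [GF], contracted with X, gives the trace. *)
Lemma twirl N d (g : 'I_N -> 'M[C]_d) (X : 'M[C]_d) :
  majorana g -> ~~ odd N -> (2 ^ N = d * d)%N ->
  \sum_T gset g T *m X *m gset g T = (d%:R * \tr X)%:M.
Proof.
move=> hg oN hd.
have d0 : (d%:R : C) != 0.
  rewrite pnatr_eq0; apply/eqP => d0; move/eqP: hd.
  by rewrite d0 muln0 expn_eq0.
pose F (T : {set 'I_N}) (u : 'I_d * 'I_d) := Num.conj (gset g T u.1 u.2) / d%:R.
pose G (u : 'I_d * 'I_d) (T : {set 'I_N}) := gset g T u.1 u.2.
have FG a a' : \sum_b F a b * G b a' = (a == a')%:R.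
  transitivity (\tr (gset g a *m gset g a') / d%:R); last first.
    by rewrite (trace_gset_diag hg) // mulfK.
  rewrite -{1}(adjmx_gset hg) /mxtrace mulr_suml.
  have -> : \sum_b F a b * G b a' = \sum_i \sum_j F a (i, j) * G (i, j) a'.
    by rewrite pair_bigA /=; apply: eq_bigr => -[].
  rewrite exchange_big; apply: eq_bigr => j _ /=; rewrite mxE mulr_suml.
  by apply: eq_bigr => i _; rewrite adjmxE mulrAC.
have cA : #|{set 'I_N}| = #|{: 'I_d * 'I_d}|.
  rewrite card_prod card_ord -hd.
  have -> : #|{set 'I_N}| = #|powerset [set: 'I_N]|.
    by apply: eq_card => T; rewrite !inE finset.subsetT.
  by rewrite card_powerset cardsT card_ord.
have GF i j i' j' :
    \sum_T gset g T i j * gset g T j' i' = d%:R * ((i == i') && (j == j'))%:R.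
  have := finsum_inverse cA FG (i, j) (i', j').
  rewrite xpair_eqE /= => <-; rewrite mulr_sumr; apply: eq_bigr => T _.
  have hT : Num.conj (gset g T i' j') = gset g T j' i'.
    by rewrite -[in RHS](adjmx_gset hg T) adjmxE.
  by rewrite /G /F /= hT; field; exact: d0.
apply/matrixP => i i'; rewrite summxE.
transitivity (\sum_j \sum_j' X j j' * \sum_T gset g T i j * gset g T j' i').
  under [RHS]eq_bigr => j _.
    under eq_bigr => j' _ do rewrite mulr_sumr.
    rewrite exchange_big; over.
  rewrite exchange_big /=; apply: eq_bigr => T _.
  rewrite mxM; under [LHS]eq_bigr => j' _ do rewrite mxM mulr_suml.
  rewrite [LHS]exchange_big; apply: eq_bigr => j _; apply: eq_bigr => j' _ /=; ring.
rewrite mxE /mxtrace mulr_sumr -sumrMnl; apply: eq_bigr => j _.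
under eq_bigr => j' _ do rewrite GF.
rewrite (bigD1 j) //= big1 ?addr0 => [|j' jj'].
  by rewrite eqxx andbT; case: (i == i'); rewrite ?mulr1 ?mulr0 // mulrC.
by rewrite [j == j']eq_sym (negbTE jj') andbF !mulr0.
Qed.

End Measurability.

(** * Criteria for compatibility and incompatibility *)

Section Robustness.
Variable R : realType.
Local Notation C := R[i].

Section Fixed_n.
Variables (n : nat) (g : 'I_(2 * n) -> 'M[C]_(2 ^ n)).
Hypothesis hg : is_majorana g.

Let hg' : majorana g. Proof. exact: hg. Qed.

Lemma gammaSE S : gammaS g S = gset g S.
Proof. by rewrite gsetE. Qed.

Lemma odd_2n : ~~ odd (2 * n).
Proof. by rewrite oddM. Qed.

Lemma pow2_sqr : (2 ^ (2 * n) = 2 ^ n * 2 ^ n)%N.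
Proof. by rewrite -expnD addnn mul2n. Qed.

Lemma card_Sm m : #|{: Sm n m}| = 'C(2 * n, m).
Proof.
rewrite card_sig -[in RHS](card_ord (2 * n)) -card_draws.
by apply: eq_card => S; rewrite !inE.
Qed.

Definition jm m (eta : R) :=
  jointly_measurable (fun S : Sm n m => Meff g eta (val S)).

(** Multiplying the mixture for eta gamma_S by gamma_S and tracing gives eta 2^n for every S, while
    the masses of the [G l] add up to 2^n; the dimension cancels. *)
Lemma jm_bound m eta kappa :
  (forall (G : 'M[C]_(2 ^ n)) (a : Sm n m -> R), psd G -> (forall S, `|a S| <= 1) ->
     \sum_S a S * ev G (gset g (val S)) <= kappa * ev G 1%:M) ->
  jm m eta -> eta * ('C(2 * n, m))%:R <= kappa.
Proof.
move=> hk [L [G [D [[pG sG] [D0 [D1 DM]]]]]].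
(* Subtracting the effects of the two outcomes isolates gamma_S, with these coefficients. *)
pose a l S := D S l true - D S l false.
have a1 l S : `|a l S| <= 1.
  have := D1 S l; rewrite big_bool /a /=; have := D0 S l true; have := D0 S l false.
  by move=> *; rewrite ler_norml; apply/andP; split; lra.
have eM S : eta%:C%C *: gset g (val S) = \sum_l (a l S)%:C%C *: G l.
  transitivity (Meff g eta (val S) true - Meff g eta (val S) false).
    rewrite /Meff -gammaSE -scalerBr opprD addrACA subrr add0r mul1r mulN1r scaleNr opprK.
    by rewrite -mulr2n -(scaler_nat 2 (_ *: _)) scalerA mulVf ?scale1r // pnatr_eq0.
  rewrite !DM -sumrB; apply: eq_bigr => l _.
  by rewrite -scalerBl -rmorphB.
have tr1 : complex.Re (\tr (1%:M : 'M[C]_(2 ^ n))) = (2 ^ n)%:R.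
  by rewrite mxtrace1 -natrC.
have e1 : \sum_(S : Sm n m) eta * (2 ^ n)%:R =
    \sum_l \sum_S a l S * ev (G l) (gset g (val S)).
  rewrite exchange_big; apply: eq_bigr => S _.
  rewrite -tr1 -(gset_sqr hg' (val S)) -ReZ -mxtraceZ scalemxAl eM.
  rewrite mulmx_suml (raddf_sum (@mxtrace C (2 ^ n))) Re_sum; apply: eq_bigr => l _.
  by rewrite -scalemxAl /= mxtraceZ ReZ.
have e2 : \sum_l ev (G l) 1%:M = (2 ^ n)%:R.
  under eq_bigr => l _ do rewrite /ev mulmx1.
  by rewrite -Re_sum -(raddf_sum (@mxtrace C (2 ^ n))) sG.
have : \sum_(S : Sm n m) eta * (2 ^ n)%:R <= kappa * (2 ^ n)%:R.
  rewrite e1 -e2 mulr_sumr; apply: ler_sum => l _; exact: hk.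
rewrite sumr_const card_Sm -[leLHS]mulr_natr mulrAC ler_pM2r //.
by rewrite ltr0n expn_gt0.
Qed.

(* The joint POVM: pick a state [rho p] at random and conjugate it by a random [gset T]. *)
Lemma jm_of_states m (P : finType) (rho : P -> 'M[C]_(2 ^ n)) (eta : R) :
  (0 < #|P|)%N -> 0 <= eta ->
  (forall p, psd (rho p)) -> (forall p, \tr (rho p) = 1) ->
  (forall S : {set 'I_(2 * n)}, #|S| = m ->
     eta * #|P|%:R <= \sum_p `|ev (rho p) (gset g S)|) ->
  jm m eta.
Proof.
move=> P0 eta0 psr trr hS.
pose d := (2 ^ n)%N.
have d0 : (d%:R : R) != 0 by rewrite pnatr_eq0 expn_eq0.
have P0' : (#|P|%:R : R) != 0 by rewrite pnatr_eq0 -lt0n.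
pose x p S := ev (rho p) (gset g S).
(* Shrinks the available correlation to exactly eta. If the sum vanishes, [r S] is 0 and the
   hypothesis forces [eta * #|P|%:R] to be 0 as well. *)
pose r S := eta * #|P|%:R / \sum_p `|x p S|.
(* Sign acquired by [gset g S] under conjugation by [gset g T]; the response undoes it, together
   with the sign of the expectation in [rho p]. *)
pose sgn (T S : {set 'I_(2 * n)}) : R := (-1) ^+ (#|T| * #|S| + #|T :&: S|).
pose a (S : {set 'I_(2 * n)}) (l : {set 'I_(2 * n)} * P) := r S * (sgn l.1 S * Num.sg (x l.2 S)).
(* The twirl of a state is d times the identity, and there are [#|P|] states. *)
pose c : R := (d%:R * #|P|%:R)^-1.
pose G (l : {set 'I_(2 * n)} * P) := c%:C%C *: (gset g l.1 *m rho l.2 *m gset g l.1).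
have sum0 S : 0 <= \sum_p `|x p S| by apply: sumr_ge0.
have r0 S : 0 <= r S by rewrite divr_ge0 // mulr_ge0.
have r1 (S : {set 'I_(2 * n)}) : #|S| = m -> r S <= 1.
  move=> cS; have := hS S cS; rewrite /r -/(x _ _) => h.
  have [->|s0] := eqVneq (\sum_p `|x p S|) 0; first by rewrite invr0 mulr0.
  by rewrite ler_pdivrMr ?mul1r // lt_def s0 sum0.
have rE (S : {set 'I_(2 * n)}) : #|S| = m -> r S * \sum_p `|x p S| = eta * #|P|%:R.
  move=> cS; have := hS S cS; rewrite /r => h.
  have [s0|s0] := eqVneq (\sum_p `|x p S|) 0; last by rewrite divfK.
  rewrite -/(x _ _) s0 in h *; rewrite mulr0.
  by apply/eqP; rewrite eq_le h mulr_ge0.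
have a1 (S : {set 'I_(2 * n)}) l : #|S| = m -> `|a S l| <= 1.
  move=> cS; rewrite /a normrM (ger0_norm (r0 S)) normrM normrX normrN1 expr1n mul1r.
  rewrite -[leRHS]mulr1 ler_pM ?r1 //.
  by rewrite normr_sg; case: (_ != 0).
have xE p S : \tr (rho p *m gset g S) = (x p S)%:C%C.
  apply: realC_Re; rewrite -mxtrace_adjmx adjmxM adjmx_gset //.
  by case: (psr p) => -> _; rewrite mxtrace_mulC.
have tw X : \sum_T gset g T *m X *m gset g T = (d%:R * \tr X)%:M.
  by apply: twirl => //; [exact: odd_2n | exact: pow2_sqr].
have sG : \sum_l G l = 1%:M.
  transitivity (\sum_p c%:C%C *: \sum_T gset g T *m rho p *m gset g T).
    under [RHS]eq_bigr => p _ do rewrite scaler_sumr.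
    by rewrite exchange_big pair_bigA /=; apply: eq_bigr.
  under eq_bigr => p _ do rewrite tw trr mulr1 scale_scalar_mx.
  rewrite sumr_const cardT -cardE -raddfMn /=; congr (_%:M).
  rewrite -mulr_natr /c fmorphV rmorphM !rmorph_nat /=; field.
  by rewrite !pnatr_eq0 expn_eq0 -lt0n P0.
have aG (S : {set 'I_(2 * n)}) : #|S| = m -> \sum_l (a S l)%:C%C *: G l = eta%:C%C *: gset g S.
  move=> cS.
  transitivity (\sum_p (c * r S * Num.sg (x p S))%:C%C *:
      (gset g S *m \sum_T gset g T *m (gset g S *m rho p) *m gset g T)).
    under [RHS]eq_bigr => p _ do rewrite mulmx_sumr scaler_sumr.
    rewrite exchange_big pair_bigA /=; apply: eq_bigr => -[T p] _ /=.
    rewrite /a /G /= scalerA !mulmxA (gset_comm hg' S T) -!scalemxAl -!mulmxA.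
    rewrite (mulmxA (gset g S)) gset_sqr // mul1mx scalerA; congr (_ *: _).
    have -> : ((-1) ^+ (#|S| * #|T| + #|S :&: T|) : C) = (sgn T S)%:C%C.
      by rewrite /sgn rmorphXn /= rmorphN1 mulnC finset.setIC.
    by rewrite -!rmorphM /=; congr (_%:C%C); ring.
  transitivity (\sum_p (c * r S * d%:R * `|x p S|)%:C%C *: gset g S).
    apply: eq_bigr => p _; rewrite tw mxtrace_mulC xE mul_mx_scalar scalerA -natrC.
    rewrite -!rmorphM /=; congr (_%:C%C *: _).
    by rewrite normrEsg; ring.
  rewrite -scaler_suml -rmorph_sum /= -mulr_sumr; congr (_%:C%C *: _).
  rewrite (_ : _ * _ = c * d%:R * (r S * \sum_p `|x p S|)); last by ring.
  by rewrite rE // /c; field; rewrite d0 P0'.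
exists [the finType of ({set 'I_(2 * n)} * P)%type], G.
exists (fun S l (b : bool) => (1 + (if b then 1 else -1) * a (val S) l) / 2%:R).
split; first split=> //.
  move=> l; apply: psdZ; first by rewrite invr_ge0 mulr_ge0.
  by rewrite -[in X in _ *m X](adjmx_gset hg'); apply: psd_conj.
split.
  move=> S l b; have /eqP cS := valP S; have := a1 _ l cS.
  by rewrite ler_norml => /andP[]; case: b => *; lra.
split; first by move=> S l; rewrite big_bool /=; lra.
move=> S b; have /eqP cS := valP S.
rewrite /Meff gammaSE.
pose e : R := if b then 1 else -1.
have -> : (if b then 1 else -1) = e%:C%C by rewrite /e; case: (b); rewrite ?rmorphN1 ?rmorph1.
rewrite -scalerA -aG // -sG scaler_sumr -big_split scaler_sumr /=; apply: eq_bigr => l _.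
rewrite [e%:C%C *: _]scalerA -{1}[G l]scale1r. rewrite -scalerDl scalerA; congr (_ *: _).
have -> : (2^-1 : C) = (2^-1 : R)%:C%C by rewrite fmorphV rmorph_nat.
rewrite -[X in X + _]/((1 : R)%:C%C) -rmorphM -rmorphD -rmorphM /=.
by congr (_%:C%C); rewrite mulrC.
Qed.

(** A one-point POVM answered by a fair coin; it makes the set defining [eta_star] nonempty. *)
Lemma jm0 m : jm m 0.
Proof.
exists unit, (fun=> 1%:M), (fun _ _ _ => 2%:R^-1); split; first split.
- move=> _; split; first exact: adjmx1.
  move=> v; rewrite mulmx1 mxE; apply: sumr_ge0 => i _.
  by rewrite adjmxE mul_conjC_ge0.
- by rewrite (big_pred1 tt) // => -[].
split; first by move=> *; rewrite invr_ge0.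
split; first by move=> *; rewrite big_bool /=; lra.
move=> S b; rewrite (big_pred1 tt) => [|[]//].
by rewrite /Meff mulr0 scale0r addr0 fmorphV rmorph_nat.
Qed.

Lemma eta_star_le m kappa :
  (forall eta, 0 <= eta <= 1 -> jm m eta -> eta <= kappa) -> eta_star g m <= kappa.
Proof.
move=> h; apply: ge_sup; last by move=> eta [h1 h2]; exact: h.
by exists 0; split; [rewrite lexx ler01 | exact: jm0].
Qed.

Lemma eta_star_ge m eta : 0 <= eta <= 1 -> jm m eta -> eta <= eta_star g m.
Proof.
move=> h j; apply: ub_le_sup; last by split.
by exists 1 => x [/andP[]].
Qed.

End Fixed_n.
End Robustness.

(** * The upper bound in degree two *)

Section Covariance.
Variables (R : realType) (N d : nat) (g : 'I_N -> 'M[R[i]]_d).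
Hypothesis hg : majorana g.
Local Notation C := R[i].
Local Notation I1 := (Complex 0 1 : C).

Definition cov (G : 'M[C]_d) (j k : 'I_N) : R :=
  ev G ((2^-1 : R)%:C%C *: (I1 *: (g j *m g k - g k *m g j))).

Lemma cov_anti G j k : cov G j k = - cov G k j.
Proof. by rewrite /cov -evN -!scalerN opprB. Qed.

Lemma cov_neq G j k : j != k -> cov G j k = ev G (I1 *: (g j *m g k)).
Proof.
move=> jk; rewrite /cov; congr (ev G _).
rewrite (g_anti hg (_ : k != j)) 1?eq_sym // opprK -mulr2n -scaler_nat !scalerA.
by congr (_ *: _); rewrite fmorphV rmorph_nat; field.
Qed.

Definition lincomb (v : 'I_N -> R) : 'M[C]_d := \sum_j (v j)%:C%C *: g j.

Lemma adjmx_lincomb v : adjmx (lincomb v) = lincomb v.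
Proof.
rewrite adjmx_sum; apply: eq_bigr => j _.
by rewrite adjmxZ conj_realC; case: hg => ->.
Qed.

Lemma lincombM v w :
  lincomb v *m lincomb w = \sum_j \sum_k (v j * w k)%:C%C *: (g j *m g k).
Proof.
rewrite mulmx_suml; apply: eq_bigr => j _; rewrite mulmx_sumr; apply: eq_bigr => k _.
by rewrite -scalemxAl -scalemxAr scalerA rmorphM.
Qed.

Lemma lincomb_anti v w :
  lincomb v *m lincomb w + lincomb w *m lincomb v = (2%:R * \sum_j v j * w j)%:C%C%:M.
Proof.
rewrite !lincombM [X in _ + X]exchange_big -big_split /=.
rewrite mulr_sumr rmorph_sum raddf_sum; apply: eq_bigr => j _.
rewrite -big_split /= (bigD1 j) //= big1 ?addr0 => [|k kj].
  rewrite [w j * _]mulrC -scalerDr; case: hg => _ ->; rewrite eqxx scale_scalar_mx.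
  by congr (_%:M); rewrite [RHS]rmorphM rmorph_nat mulrC.
by rewrite [w k * _]mulrC -scalerDr; case: hg => _ ->; rewrite eq_sym (negbTE kj) mul0rn raddf0 scaler0.
Qed.

Lemma lincomb_sqr v : lincomb v *m lincomb v = (\sum_j v j ^+ 2)%:C%C%:M.
Proof.
have := lincomb_anti v v; rewrite -mulr2n rmorphM -scale_scalar_mx rmorph_nat -scaler_nat => h.
by rewrite (scalerI (two_neq0 R) h); congr (_%:C%C%:M); apply: eq_bigr => j _; rewrite expr2.
Qed.

(* Positivity of [Y Y^*] for [Y = V - i s W]. *)
Lemma cov_quadratic G v w s : psd G ->
  2%:R * s * \sum_j \sum_k v j * w k * cov G j k <=
  (\sum_j v j ^+ 2 + s ^+ 2 * \sum_j w j ^+ 2) * ev G 1%:M.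
Proof.
move=> pG; set V := lincomb v; set W := lincomb w.
pose Y := V + (s%:C%C * I1) *: W.
have aY : adjmx Y = V - (s%:C%C * I1) *: W.
  by rewrite adjmxD adjmxZ !adjmx_lincomb rmorphM /= conj_realC conj_i mulrN scaleNr.
have eY : Y *m adjmx Y = ((\sum_j v j ^+ 2)%:C%C%:M + (s ^+ 2 * \sum_j w j ^+ 2)%:C%C%:M)
    - (2%:R * s)%:C%C *: ((2^-1 : R)%:C%C *: (I1 *: (V *m W - W *m V))).
  rewrite aY mulmxBr !mulmxDl -!scalemxAl -!scalemxAr !lincomb_sqr.
  have cc : (s%:C%C * I1) * (s%:C%C * I1) = - (s ^+ 2)%:C%C.
    by rewrite mulrACA i_sqr mulrN1 -rmorphM expr2.
  rewrite (scalerA (s%:C%C * I1)) cc scale_scalar_mx.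
  rewrite mulNr [(- _)%:M]raddfN /=.
  have cI : (2%:R * s)%:C%C * (2^-1 : R)%:C%C * I1 = s%:C%C * I1.
    by rewrite -rmorphM; congr (_%:C%C * _); field.
  rewrite [(s ^+ 2 * _)%:C%C]rmorphM /= 2!scalerA cI scalerBr !opprB -!addrA.
  by congr (_ + _); rewrite addrCA.
have e2 : ev G ((2^-1 : R)%:C%C *: (I1 *: (V *m W - W *m V))) = \sum_j \sum_k v j * w k * cov G j k.
  rewrite !lincombM [X in _ - X]exchange_big -sumrB !scaler_sumr ev_sum.
  apply: eq_bigr => j _; rewrite -sumrB !scaler_sumr ev_sum; apply: eq_bigr => k _.
  by rewrite -evZ [w k * _]mulrC -scalerBr !scalerA; congr (ev G (_ *: _)); ring.
have := ev_psd Y pG; rewrite eY evD evN evZ e2 evD (evC G (\sum_j v j ^+ 2)) (evC G (s ^+ 2 * _)) -mulrDl.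
by rewrite subr_ge0.
Qed.

(** The quadratic inequality is optimal at s = sqrt V / sqrt W. *)
Lemma cov_cauchy G v w (V W : R) : psd G ->
  \sum_j v j ^+ 2 = V -> \sum_j w j ^+ 2 <= W -> 0 < V -> 0 <= ev G 1%:M ->
  \sum_j \sum_k v j * w k * cov G j k <= Num.sqrt (V * W) * ev G 1%:M.
Proof.
move=> pG hV hW V0 t0; set x := (X in X <= _); set t := ev G 1%:M in t0 *.
have w0 : 0 <= \sum_j w j ^+ 2 by apply: sumr_ge0 => j _; apply: sqr_ge0.
have q s : 2%:R * s * x <= (V + s ^+ 2 * W) * t.
  apply: le_trans (cov_quadratic v w s pG) _; rewrite hV ler_wpM2r // lerD2l.
  by rewrite ler_wpM2l ?sqr_ge0.
have [W0|W0] := eqVneq W 0.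
  rewrite W0 mulr0 sqrtr0 mul0r leNgt; apply/negP => x0.
  (* For W = 0 the bound 2 s x <= V t holds for every s; this s makes the left side V t + 1. *)
  have := q ((V * t + 1) / (2%:R * x)); rewrite W0 mulr0 addr0.
  have -> : 2%:R * ((V * t + 1) / (2%:R * x)) * x = V * t + 1 by field; rewrite gt_eqF.
  by lra.
have Wp : 0 < W by rewrite lt_def W0 (le_trans w0).
have sV := sqr_sqrtr (ltW V0); have sW := sqr_sqrtr (ltW Wp).
have sV0 : 0 < Num.sqrt V by rewrite sqrtr_gt0.
have sW0 : 0 < Num.sqrt W by rewrite sqrtr_gt0.
have := q (Num.sqrt V / Num.sqrt W); rewrite expr_div_n sV sW divfK // => h.
have {}h : Num.sqrt V / Num.sqrt W * x <= V * t by lra.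
have r0 : 0 < Num.sqrt V / Num.sqrt W by rewrite divr_gt0.
rewrite (sqrtrM _ (ltW V0)) -(ler_pM2l r0).
apply: le_trans h _; rewrite -[in leLHS]sV le_eqVlt; apply/orP; left; apply/eqP; field.
by rewrite gt_eqF.
Qed.

End Covariance.

(** * Sums over two-element subsets *)

Lemma sorted_enum_ord N (S : {set 'I_N}) : sorted (fun j k : 'I_N => (j < k)%N) (enum S).
Proof.
apply: (@sorted_filter _ (fun j k : 'I_N => (j < k)%N)); first by move=> ? ? ?; apply: ltn_trans.
have := iota_ltn_sorted 0 N; rewrite -val_enum_ord sorted_map.
by rewrite enumT.
Qed.

Lemma enum_pair N (j k : 'I_N) : (j < k)%N -> enum [set j; k] = [:: j; k].
Proof.
move=> jk; apply: (@irr_sorted_eq _ (fun j k : 'I_N => (j < k)%N)).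
- by move=> ? ? ?; apply: ltn_trans.
- by move=> ?; rewrite ltnn.
- exact: sorted_enum_ord.
- by rewrite /= jk.
by move=> x; rewrite mem_enum !inE.
Qed.

Lemma gset_pair (R : realType) N d (g : 'I_N -> 'M[R[i]]_d) (j k : 'I_N) : (j < k)%N ->
  gset g [set j; k] = (Complex 0 1 : R[i]) *: (g j *m g k).
Proof. by move=> jk; rewrite gset_seq /gseq enum_pair //= binn expr1 mulmx1. Qed.

Lemma sum_pairs (R : nmodType) N (F : {set 'I_N} -> R) :
  \sum_(S : {set 'I_N} | #|S| == 2) F S = \sum_(j < N) \sum_(k < N | (j < k)%N) F [set j; k].
Proof.
case: N F => [|N] F.
  rewrite big_ord0 big1 // => S /eqP cS.
  by have := max_card (mem S); rewrite cS card_ord.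
pose h (p : 'I_N.+1 * 'I_N.+1) := [set p.1; p.2].
pose h' (S : {set 'I_N.+1}) := (nth ord0 (enum S) 0, nth ord0 (enum S) 1).
rewrite (reindex_onto h h') /= => [|S cS]; last first.
  have : size (enum S) = 2 by rewrite -cardE; apply/eqP.
  rewrite /h /h'; case e : (enum S) => [|a [|b []]] //= _.
  by apply/setP => x; rewrite -(mem_enum S) e !inE.
rewrite pair_big_dep /=; apply: eq_bigl => -[j k]; rewrite /h /=.
have [jk|kj|/val_inj jk] := ltngtP j k.
- by rewrite cards2 neq_ltn jk /h' enum_pair //= eqxx.
- rewrite finset.setUC /h' enum_pair //= xpair_eqE.
  by rewrite andbC -val_eqE /= (ltn_eqF kj).
- by rewrite jk finset.setUid cards1.
Qed.

Lemma sum_Sm (R : pzSemiRingType) n m (a : Sm n m -> R) (F : {set 'I_(2 * n)} -> R) :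
  \sum_S a S * F (val S) = \sum_(S : {set 'I_(2 * n)} | #|S| == m) (if insub S is Some s then a s else 0) * F S.
Proof.
rewrite [RHS](reindex_omap (val : Sm n m -> {set 'I_(2 * n)}) insub) => [|S cS].
  apply: eq_big => [S|S _]; last by rewrite valK.
  by rewrite valK eqxx andbT; case: S.
by rewrite insubT.
Qed.

(** * Row estimates for skew sign matrices *)

Section DegreeTwo.
Variables (R : realType).

Definition antimx N (b : {set 'I_N} -> R) (j k : 'I_N) : R :=
  if (j < k)%N then b [set j; k] else if (k < j)%N then - b [set j; k] else 0.

Lemma antimx_anti N (b : {set 'I_N} -> R) j k : antimx b j k = - antimx b k j.
Proof.
by rewrite /antimx finset.setUC; case: ltngtP; rewrite ?opprK ?oppr0.
Qed.

Lemma antimx_diag N (b : {set 'I_N} -> R) j : antimx b j j = 0.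
Proof. by rewrite /antimx ltnn. Qed.

Lemma sum_lt_half N (f : 'I_N -> 'I_N -> R) :
  (forall j k, f j k = f k j) -> (forall j, f j j = 0) ->
  \sum_(j < N) \sum_(k < N | (j < k)%N) f j k = 2^-1 * \sum_(j < N) \sum_(k < N) f j k.
Proof.
move=> fs f0.
have -> : \sum_(j < N) \sum_(k < N) f j k =
    \sum_(j < N) \sum_(k < N | (j < k)%N) f j k + \sum_(j < N) \sum_(k < N | (k < j)%N) f j k.
  rewrite -big_split /=; apply: eq_bigr => j _.
  rewrite (bigID (fun k : 'I_N => (j < k)%N)) /=; congr (_ + _).
  rewrite [LHS](bigD1 j) ?ltnn //= f0 add0r; apply: eq_bigl => k.
  by rewrite -leqNgt -val_eqE /= [in RHS]ltn_neqAle andbC.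
have -> : \sum_(j < N) \sum_(k < N | (k < j)%N) f j k = \sum_(j < N) \sum_(k < N | (j < k)%N) f j k.
  rewrite (exchange_big_dep xpredT) //=; apply: eq_bigr => j _.
  by apply: eq_bigr => k _; rewrite fs.
lra.
Qed.

Section Polarization.
Variable N : nat.

Definition indic (j i : 'I_N) : R := (i == j)%:R.

Lemma sum_indic j (f : 'I_N -> R) : \sum_i indic j i * f i = f j.
Proof.
rewrite (bigD1 j) //= /indic eqxx mul1r big1 ?addr0 // => i /negbTE ->.
by rewrite mul0r.
Qed.

Lemma row_indic (K : 'I_N -> 'I_N -> R) (w : 'I_N -> R) j :
  \sum_k w k * K j k = \sum_i \sum_k indic j i * w k * K i k.
Proof.
transitivity (\sum_i indic j i * \sum_k w k * K i k); first by rewrite sum_indic.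
by apply: eq_bigr => i _; rewrite mulr_sumr; apply: eq_bigr => k _; rewrite mulrA.
Qed.

(** Polarization: e_j v + e_k w is half of (e_j + e_k)(v + w) + (e_j - e_k)(v - w). The literal
    factors 1 and -1 make both terms instances of one estimate with a sign s. *)
Lemma rows_polarize (K : 'I_N -> 'I_N -> R) (v w : 'I_N -> R) j k :
  \sum_l v l * K j l + \sum_l w l * K k l = 2^-1 *
  (\sum_i \sum_l (indic j i + 1 * indic k i) * (v l + 1 * w l) * K i l +
   \sum_i \sum_l (indic j i + (-1) * indic k i) * (v l + (-1) * w l) * K i l).
Proof.
rewrite (row_indic K v j) (row_indic K w k) -2!big_split /= mulr_sumr.
apply: eq_bigr => i _; rewrite -2!big_split /= mulr_sumr; apply: eq_bigr => l _.
by field.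
Qed.

Lemma sum_pair_le (x : 'I_N -> R) u v j k : j != k ->
  (forall i, x i <= u) -> x j + x k <= v -> \sum_i x i <= (N%:R - 2%:R) * u + v.
Proof.
move=> jk xu xv; rewrite (bigD1 j) //= (bigD1 k) 1?eq_sym //= addrA addrC.
apply: lerD => //.
apply: (@le_trans _ _ (\sum_(i | (i != j) && (i != k)) u)); first exact: ler_sum.
have c2 : #|pred2 j k| = 2 by rewrite card2 jk.
rewrite sumr_const -[leLHS]mulr_natl.
have -> : #|(fun i : 'I_N => (i != j) && (i != k))| = (N - 2)%N.
  have := cardC (pred2 j k); rewrite c2 card_ord => cN.
  by rewrite -[in RHS]cN addKn; apply: eq_card => i; rewrite !inE negb_or.
have N2 : (2 <= N)%N by have := max_card (pred2 j k); rewrite c2 card_ord.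
by rewrite natrB.
Qed.

End Polarization.

Variables (N d : nat) (g : 'I_N -> 'M[R[i]]_d) (G : 'M[R[i]]_d).
Hypotheses (hg : majorana g) (pG : psd G).

Local Notation t := (ev G 1%:M).

Lemma ev1_ge0 : 0 <= t.
Proof. by have := ev_psd 1%:M pG; rewrite adjmx1 mulmx1. Qed.

Lemma sum2_cov (b : {set 'I_N} -> R) :
  \sum_(S : {set 'I_N} | #|S| == 2) b S * ev G (gset g S) =
  2^-1 * \sum_j \sum_k antimx b j k * cov g G j k.
Proof.
rewrite -sum_lt_half => [|j k|j].
- rewrite sum_pairs; apply: eq_bigr => j _; apply: eq_bigr => k jk.
  have njk : j != k by rewrite -val_eqE /= (ltn_eqF jk).
  by rewrite (gset_pair g jk) /antimx jk (cov_neq hg G njk).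
- by rewrite antimx_anti cov_anti mulrNN.
by rewrite antimx_diag mul0r.
Qed.

Variable (b : {set 'I_N} -> R).
Hypothesis b1 : forall S, `|b S| <= 1.
Local Notation A := (antimx b).
Local Notation M := ((N.-1)%:R : R).
Local Notation row_cov j := (\sum_k A j k * cov g G j k).

Lemma antimx_le1 j k : `|A j k| <= 1.
Proof. by rewrite /antimx; case: ifP => _ //; case: ifP => _; rewrite ?normrN ?normr0. Qed.

Lemma antimx_row j : \sum_k A j k ^+ 2 <= M.
Proof.
rewrite (bigD1 j) //= antimx_diag expr0n add0r.
apply: (@le_trans _ _ (\sum_(k | k != j) 1)).
  by apply: ler_sum => k _; rewrite -real_normK ?num_real // expr_le1 ?antimx_le1.
by rewrite sumr_const (cardC1 j) card_ord.
Qed.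

Lemma row_cov_le j : row_cov j <= Num.sqrt M * t.
Proof.
have := cov_cauchy hg (v := indic j) (w := A j) (V := 1) (W := M) pG.
rewrite mul1r => h; apply: le_trans (h _ _ _ _).
- by rewrite {1}(row_indic (cov g G)).
- by under eq_bigr => i _ do rewrite expr2; rewrite sum_indic /indic eqxx.
- exact: antimx_row.
- exact: ltr01.
exact: ev1_ge0.
Qed.

Lemma sum2_le : \sum_(S : {set 'I_N} | #|S| == 2) b S * ev G (gset g S) <=
  2^-1 * (N%:R * Num.sqrt M) * t.
Proof.
rewrite sum2_cov -mulrA ler_pM2l ?invr_gt0 //.
apply: (@le_trans _ _ (\sum_(j < N) Num.sqrt M * t)); first by apply: ler_sum => j _; exact: row_cov_le.
by rewrite sumr_const card_ord -[leLHS]mulr_natl mulrA.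
Qed.

(* Replacing two rows of A by their sum and difference, whose lengths are unequal unless the rows
   are orthogonal, improves on [row_cov_le]. *)
Lemma row_cov_pair_le j k c : j != k -> \sum_l A j l * A k l = c ->
  row_cov j + row_cov k <= (Num.sqrt (M + c) + Num.sqrt (M - c)) * t.
Proof.
move=> jk hc.
(* The test vector e_j + s e_k has squared length 2, the combined row at most 2 (M + s c). *)
have sq (s : R) : s ^+ 2 = 1 ->
    \sum_i \sum_l (indic j i + s * indic k i) * (A j l + s * A k l) * cov g G i l <=
    2%:R * Num.sqrt (M + s * c) * t.
  move=> s1; have := cov_cauchy hg (v := fun i => indic j i + s * indic k i)
    (w := fun l => A j l + s * A k l) (V := 2%:R) (W := 2%:R * (M + s * c)) pG.
  have -> : Num.sqrt (2%:R * (2%:R * (M + s * c))) = 2%:R * Num.sqrt (M + s * c).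
    by rewrite mulrA -expr2 sqrtrM ?sqr_ge0 // sqrtr_sqr ger0_norm.
  apply => //; last exact: ev1_ge0.
    have e i : (indic j i + s * indic k i) ^+ 2 =
        indic j i * 1 + indic k i * s ^+ 2 + 2%:R * s * (indic j i * indic k i).
      by rewrite /indic; case: (i == j); case: (i == k) => /=; ring.
    under eq_bigr => i _ do rewrite e.
    rewrite !big_split /= !sum_indic -mulr_sumr sum_indic /indic (negbTE jk) s1.
    by rewrite mulr0 addr0.
  have e l : (A j l + s * A k l) ^+ 2 =
      A j l ^+ 2 + s ^+ 2 * A k l ^+ 2 + 2%:R * s * (A j l * A k l) by ring.
  under eq_bigr => l _ do rewrite e.
  rewrite !big_split /= -!mulr_sumr hc s1; have := antimx_row j; have := antimx_row k.
  lra.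
have h1 := sq 1 (expr1n _ _); have h2 := sq (-1) (sqrr_sign _ 1).
have e := rows_polarize (cov g G) (A j) (A k) j k.
rewrite e; apply: (le_trans (ler_wpM2l _ (lerD h1 h2))); first by rewrite invr_ge0.
rewrite mul1r mulN1r; move: (ev G 1%:M) (Num.sqrt _) (Num.sqrt _) => T x y.
by rewrite le_eqVlt; apply/orP; left; apply/eqP; field.
Qed.

Lemma sum2_pair_le (j k : 'I_N) c : j != k -> \sum_l A j l * A k l = c ->
  \sum_(S : {set 'I_N} | #|S| == 2) b S * ev G (gset g S) <=
  2^-1 * ((N%:R - 2%:R) * Num.sqrt M + (Num.sqrt (M + c) + Num.sqrt (M - c))) * t.
Proof.
move=> jk hc; rewrite sum2_cov -mulrA ler_pM2l ?invr_gt0 //.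
rewrite mulrDl -mulrA; apply: (sum_pair_le jk) => [i|].
  exact: row_cov_le.
exact: row_cov_pair_le.
Qed.

End DegreeTwo.

(** * From sign matrices to the robustness in degree two *)

Section DegreeTwoRobustness.
Variable R : realType.

Lemma bin2_natr N : 2%:R * ('C(N, 2))%:R = N%:R * (N.-1)%:R :> R.
Proof.
rewrite -!natrM; congr (_%:R).
by case: N => [|N] //; rewrite mulnC -[X in (_ * X)%N]/(2`!) bin_ffact ffactnS ffactn1.
Qed.

Section SignMatrix.
Variables (N : nat) (s : {set 'I_N} -> bool).

Definition sgn_set (S : {set 'I_N}) : R := if s S then 1 else -1.

(** Integer copy of [antimx sgn_set]: products of rows become integers, and the Hadamard condition
    lives over [int]. *)
Definition skew_sign (j k : 'I_N) : int :=
  if (j < k)%N then (if s [set j; k] then 1 else -1)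
  else if (k < j)%N then - (if s [set j; k] then 1 else -1) else 0.

Definition skew_mx : 'M[int]_N := \matrix_(j, k) ((j == k)%:R + skew_sign j k).

Lemma skew_signE j k : antimx sgn_set j k = (skew_sign j k)%:~R.
Proof.
rewrite /antimx /sgn_set /skew_sign; case: ifP => _; first by case: (s _).
by case: ifP => _ //; case: (s _); rewrite ?rmorphN ?opprK.
Qed.

Lemma skew_sign_anti j k : skew_sign j k = - skew_sign k j.
Proof. by rewrite /skew_sign finset.setUC; case: ltngtP; rewrite ?opprK ?oppr0. Qed.

Lemma skew_sign_sqr j k : skew_sign j k * skew_sign j k = (j != k)%:R.
Proof.
rewrite /skew_sign -val_eqE /=; case: ltngtP => _ //; by case: (s _).
Qed.

(** For skew a, (I + a)(I + a)^T = I + a a^T; orthogonal rows leave only the diagonal of a a^T,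
    equal to N - 1. *)
Lemma skew_mx_hadamard :
  (forall j k, j != k -> \sum_l skew_sign j l * skew_sign k l = 0) -> skew_hadamard skew_mx.
Proof.
move=> orth; split; first split.
- move=> j k; rewrite mxE /skew_sign -val_eqE /=.
  case: ltngtP => _; rewrite ?add0r ?addr0; last by left.
    by case: (s _); [left | right].
  by case: (s _); rewrite ?opprK; [right | left].
- apply/matrixP => j k; rewrite mxM mxE.
  have e l : skew_mx j l * skew_mx^T l k = (j == l)%:R * (k == l)%:R + (j == l)%:R * skew_sign k l
      + (k == l)%:R * skew_sign j l + skew_sign j l * skew_sign k l.
    by rewrite !mxE; ring.
  under eq_bigr => l _ do rewrite e.
  have pick (i : 'I_N) (f : 'I_N -> int) : \sum_l (i == l)%:R * f l = f i.
    rewrite (bigD1 i) //= eqxx mul1r big1 ?addr0 // => l /negbTE.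
    by rewrite eq_sym => ->; rewrite mul0r.
  rewrite !big_split /= !pick (skew_sign_anti k j) addrNK [k == j]eq_sym.
  have [<-|jk] := eqVneq j k; last by rewrite orth.
  under eq_bigr => l _ do rewrite skew_sign_sqr.
  have -> : \sum_l ((j != l)%:R : int) = \sum_(l | j != l) 1.
    by rewrite [RHS]big_mkcond; apply: eq_bigr => l _; case: (j != l).
  rewrite sumr_const -mulrS; congr (_%:R).
  have := cardC1 j; rewrite card_ord => cj.
  have N0 : (0 < N)%N by apply: leq_ltn_trans (ltn_ord j).
  rewrite -[RHS](prednK N0) -cj; congr _.+1; apply: eq_card => l.
  by rewrite !inE eq_sym.
apply/matrixP => j k; rewrite !mxE [k == j]eq_sym addrACA (skew_sign_anti k j) subrr addr0.
by case: (j == k).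
Qed.

End SignMatrix.

Section Bounds.
Variables (n : nat) (g : 'I_(2 * n) -> 'M[R[i]]_(2 ^ n)).
Hypotheses (hg : is_majorana g) (n1 : (1 <= n)%N).

Local Notation M := (((2 * n).-1)%:R : R).
Local Notation NR := ((2 * n)%:R : R).

Lemma M_ge1 : 1 <= M.
Proof. by rewrite ler1n; lia. Qed.

(** A linear function of coefficients in [-1, 1] is largest at the signs of the expectations, so
    sign patterns suffice. The factor 1/2 reflects 2 'C(N, 2) = N (N - 1). *)
Lemma jm2_bound kappa eta :
  (forall G, psd G -> forall s : {set 'I_(2 * n)} -> bool,
   \sum_(S : {set 'I_(2 * n)} | #|S| == 2) sgn_set s S * ev G (gset g S) <=
     2^-1 * kappa * ev G 1%:M) ->
  jm g 2 eta -> eta * (NR * M) <= kappa.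
Proof.
move=> hk /(jm_bound hg (kappa := 2^-1 * kappa)) h.
rewrite -bin2_natr; suff : eta * ('C(2 * n, 2))%:R <= 2^-1 * kappa.
  move: ('C(2 * n, 2)%:R : R) => c hc.
  by rewrite mulrCA -ler_pdivlMl.
apply: h => G a pG a1.
apply: le_trans (hk G pG (fun S => 0 <= ev G (gset g S))).
have /= -> := sum_Sm a (fun S => ev G (gset g S)); apply: ler_sum => S _; rewrite /sgn_set.
have a1' : `|if insub S is Some t then a t else 0| <= 1.
  by case: insub => [t|]; rewrite ?normr0.
apply: le_trans (ler_norm _) _; rewrite normrM.
apply: (@le_trans _ _ (1 * `|ev G (gset g S)|)); first by rewrite ler_wpM2r.
by rewrite mul1r; case: (lerP 0 (ev G _)) => h0; rewrite ?mul1r ?mulN1r ?(ger0_norm h0) // ltr0_norm.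
Qed.

Lemma sgn_set_le1 (s : {set 'I_(2 * n)} -> bool) S : `|sgn_set s S| <= 1.
Proof. by rewrite /sgn_set; case: (s S); rewrite ?normrN1 ?normr1. Qed.

Lemma jm2_le eta : jm g 2 eta -> eta <= 1 / Num.sqrt M.
Proof.
have hg' : majorana g := hg.
have M0 : 0 < M by apply: lt_le_trans M_ge1.
have N0 : 0 < NR by rewrite ltr0n; lia.
move=> /(jm2_bound (kappa := NR * Num.sqrt M)) h.
have {}h : eta * (NR * M) <= NR * Num.sqrt M.
  by apply: h => G pG s; apply: (sum2_le hg' pG) => S; apply: sgn_set_le1.
rewrite -(ler_pM2r (_ : 0 < NR * M)) ?mulr_gt0 //; apply: le_trans h _.
have s0 : Num.sqrt M != 0 by rewrite gt_eqF // sqrtr_gt0.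
rewrite le_eqVlt; apply/orP; left; apply/eqP.
by move: (sqr_sqrtr (ltW M0)) s0; set s := Num.sqrt M => <- s0; field.
Qed.

(** Equals sqrt (M + 1) + sqrt (M - 1), the largest value of sqrt (M + c) + sqrt (M - c) over
    nonzero integers c with |c| <= M, in a form suited to comparing squares. *)
Definition gap_bound : R := Num.sqrt (2%:R * M + 2%:R * Num.sqrt (M ^+ 2 - 1)).

Lemma gap_bound_lt : gap_bound < 2%:R * Num.sqrt M.
Proof.
have M1 := M_ge1.
have -> : 2%:R * Num.sqrt M = Num.sqrt (4%:R * M).
  have -> : 4%:R * M = 2%:R ^+ 2 * M by ring.
  by rewrite sqrtrM ?sqr_ge0 // sqrtr_sqr ger0_norm.
rewrite ltr_sqrt; last by lra.
suff : Num.sqrt (M ^+ 2 - 1) < M by move=> h; lra.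
have MM : 0 <= M by lra.
by rewrite -[ltRHS](ger0_norm MM) -sqrtr_sqr ltr_sqrt; nra.
Qed.

Lemma gap_boundP (c : int) : c != 0 -> c%:~R <= M -> - M <= c%:~R ->
  Num.sqrt (M + c%:~R) + Num.sqrt (M - c%:~R) <= gap_bound.
Proof.
move=> c0; have : 1 <= (c%:~R : R) ^+ 2.
  by rewrite -rmorphXn /= ler1z; move: c0; clear; nia.
move: (c%:~R : R) => x x1 h1 h2; have M1 := M_ge1.
have a0 : 0 <= M + x by lra.
have b0 : 0 <= M - x by lra.
rewrite -[leLHS]ger0_norm ?addr_ge0 ?sqrtr_ge0 // -sqrtr_sqr; apply: ler_wsqrtr.
rewrite sqrrD !sqr_sqrtr // -sqrtrM //.
have : Num.sqrt ((M + x) * (M - x)) <= Num.sqrt (M ^+ 2 - 1).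
  by apply: ler_wsqrtr; nra.
rewrite -mulr_natl; lra.
Qed.

Lemma jm2_gap eta : ~ (exists H : 'M[int]_(2 * n), skew_hadamard H) ->
  jm g 2 eta -> eta * (NR * M) <= (NR - 2%:R) * Num.sqrt M + gap_bound.
Proof.
have hg' : majorana g := hg.
move=> noH; apply: jm2_bound => G pG s.
(* Pairwise orthogonal rows would make [skew_mx s] skew-Hadamard, so some pair has a nonzero integer
   product. *)
have [/existsP[j /existsP[k /andP[jk c0]]]|] :=
  boolP [exists j, exists k, (j != k) && (\sum_l skew_sign s j l * skew_sign s k l != 0)]; last first.
  rewrite negb_exists => /forallP orth; case: noH; exists (skew_mx s).
  apply: skew_mx_hadamard => j k jk; apply/eqP.
  by have := orth j; rewrite negb_exists => /forallP/(_ k); rewrite jk negbK.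
have e : \sum_l antimx (sgn_set s) j l * antimx (sgn_set s) k l =
    (\sum_l skew_sign s j l * skew_sign s k l)%:~R.
  by rewrite rmorph_sum /=; apply: eq_bigr => l _; rewrite !skew_signE rmorphM.
have row i : \sum_l antimx (sgn_set s) i l ^+ 2 <= M.
  by apply: antimx_row => S; apply: sgn_set_le1.
apply: le_trans (sum2_pair_le hg' pG (fun S => sgn_set_le1 s S) jk e) _.
apply: ler_wpM2r; first exact: ev1_ge0.
rewrite ler_pM2l ?invr_gt0 // lerD2l; apply: gap_boundP => //; rewrite -e.
  (* Both bounds on the product of the rows come from 2 |x y| <= x^2 + y^2, entrywise. *)
  apply: (@le_trans _ _ (2^-1 * (\sum_l antimx (sgn_set s) j l ^+ 2 + \sum_l antimx (sgn_set s) k l ^+ 2))).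
    rewrite -big_split mulr_sumr; apply: ler_sum => l _ /=.
    by move: (antimx _ _ _) (antimx _ _ _) => x y; have := sqr_ge0 (x - y); rewrite !expr2; lra.
  have := row j; have := row k; lra.
apply: (@le_trans _ _ (- 2^-1 * (\sum_l antimx (sgn_set s) j l ^+ 2 + \sum_l antimx (sgn_set s) k l ^+ 2))).
  have := row j; have := row k; lra.
rewrite -big_split mulr_sumr; apply: ler_sum => l _ /=.
by move: (antimx _ _ _) (antimx _ _ _) => x y; have := sqr_ge0 (x + y); rewrite !expr2; lra.
Qed.

Lemma eta2_le : eta_star g 2 <= 1 / Num.sqrt M.
Proof. by apply: (eta_star_le) => eta _; exact: jm2_le. Qed.

(** The gap is the same for every compatible eta, so it passes to the supremum; strictness for each
    eta alone would not. *)
Lemma eta2_lt : ~ (exists H : 'M[int]_(2 * n), skew_hadamard H) ->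
  eta_star g 2 < 1 / Num.sqrt M.
Proof.
move=> noH; have M0 : 0 < M by apply: lt_le_trans M_ge1.
have N0 : 0 < NR by rewrite ltr0n; lia.
have NM : 0 < NR * M by rewrite mulr_gt0.
apply: (@le_lt_trans _ _ (((NR - 2%:R) * Num.sqrt M + gap_bound) / (NR * M))).
  by apply: (eta_star_le) => eta _ /(jm2_gap noH); rewrite ler_pdivlMr.
rewrite ltr_pdivrMr //.
have s0 : Num.sqrt M != 0 by rewrite gt_eqF // sqrtr_gt0.
have -> : 1 / Num.sqrt M * (NR * M) = NR * Num.sqrt M.
  by move: (sqr_sqrtr (ltW M0)) s0; set s := Num.sqrt M => <- s0; field.
have := gap_bound_lt; lra.
Qed.

End Bounds.
End DegreeTwoRobustness.

(** * Gaussian states and the lower bounds *)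

(** If v is not killed by [B x], replace it by [v *m B x]: nilpotency makes [B x] kill it, and
    anticommutation keeps it killed by the earlier matrices. *)
Lemma anticommuting_null (K : fieldType) d (I : eqType) (B : I -> 'M[K]_d) (s : seq I) :
  (0 < d)%N -> (forall a b, B a *m B b = - (B b *m B a)) -> (forall a, B a *m B a = 0) ->
  exists2 v : 'rV[K]_d, v != 0 & forall a, a \in s -> v *m B a = 0.
Proof.
move=> d0 anti nil; elim: s => [|x s [v v0 vs]].
  exists (const_mx 1) => //; apply/eqP => /matrixP/(_ 0 (Ordinal d0)) /eqP.
  by rewrite !mxE oner_eq0.
have [vx|vx] := eqVneq (v *m B x) 0.
  by exists v => // a; rewrite inE => /orP[/eqP->|/vs].
exists (v *m B x) => // a; rewrite inE => /orP[/eqP->|/vs va].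
  by rewrite -mulmxA nil mulmx0.
by rewrite -mulmxA anti mulmxN mulmxA va mul0mx oppr0.
Qed.

Section Gaussian.
Variables (R : realType) (M d : nat) (g : 'I_M -> 'M[R[i]]_d).
Local Notation C := R[i].
Local Notation I1 := (Complex 0 1 : C).
Hypotheses (hg : majorana g) (d0 : (0 < d)%N).
Variable Gam : 'I_M -> 'I_M -> R.
Hypothesis Ganti : forall a b, Gam a b = - Gam b a.
Hypothesis Gorth : forall a b, \sum_l Gam a l * Gam b l = (a == b)%:R.

(* A common null vector of the [annih a] has covariance matrix [Gam]. *)
Definition annih a : 'M[C]_d := g a + I1 *: lincomb g (Gam a).

Lemma lincomb_indic a : lincomb g (indic R a) = g a.
Proof.
rewrite /lincomb (bigD1 a) //= /indic eqxx rmorph1 scale1r big1 ?addr0 // => j /negbTE ->.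
by rewrite rmorph0 scale0r.
Qed.

(** Orthogonality of [Gam] cancels the real part of the anticommutator, skewness the imaginary
    part. *)
Lemma annih_anti a b : annih a *m annih b + annih b *m annih a = 0.
Proof.
rewrite /annih -!(lincomb_indic) !mulmxDl !mulmxDr -!scalemxAr -!scalemxAl !scalerA i_sqr.
have ee := lincomb_anti hg (indic R a) (indic R b).
have ew := lincomb_anti hg (indic R a) (Gam b).
have we := lincomb_anti hg (Gam a) (indic R b).
have ww := lincomb_anti hg (Gam a) (Gam b).
rewrite sum_indic in ee; rewrite sum_indic in ew; rewrite Gorth in ww.
have e1 : \sum_j Gam a j * indic R b j = Gam a b.
  by rewrite -[RHS](sum_indic b (Gam a)); apply: eq_bigr => j _; rewrite mulrC.
rewrite e1 Ganti mulrN in we.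
move: ee ew we ww; rewrite /indic.
move: (lincomb g (Gam a)) (lincomb g (Gam b)) (lincomb g _) (lincomb g _) => wa wb eb ea.
move=> ee ew we ww.
transitivity ((ea *m eb + eb *m ea) + I1 *: ((ea *m wb + wb *m ea) + (wa *m eb + eb *m wa))
   - (wa *m wb + wb *m wa)).
  rewrite !scalerDr !scaleN1r opprD.
  move: (ea *m eb) (eb *m ea) (I1 *: (ea *m wb)) (I1 *: (wb *m ea)) (I1 *: (wa *m eb))
    (I1 *: (eb *m wa)) (wa *m wb) (wb *m wa) => x1 x2 x3 x4 x5 x6 x7 x8.
  by apply/matrixP => i j; rewrite !mxE; ring.
rewrite ee ew we ww -[X in _ *: X]raddfD -rmorphD /= subrr raddf0 scaler0 addr0.
by rewrite eq_sym subrr.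
Qed.

Lemma gaussian_vector : exists2 v : 'rV[C]_d, v != 0 & forall a, v *m annih a = 0.
Proof.
have anti a b : annih a *m annih b = - (annih b *m annih a).
  by apply/eqP; rewrite -subr_eq0 opprK annih_anti.
have nil a : annih a *m annih a = 0.
  have := annih_anti a a; rewrite -mulr2n -scaler_nat => /eqP.
  by rewrite scaler_eq0 (negbTE (two_neq0 R)) => /eqP.
have [v v0 h] := anticommuting_null (enum 'I_M) d0 anti nil.
by exists v => // a; apply: h; rewrite mem_enum.
Qed.

(** The last two clauses are [rho *m annih a = 0] and its adjoint [adjmx (annih a) *m rho = 0],
    tested against every X under the trace. *)
Definition gaussian (rho : 'M[C]_d) := [/\ psd rho, \tr rho = 1,
  (forall a X, \tr (rho *m (g a *m X)) = - I1 * \sum_l (Gam a l)%:C%C * \tr (rho *m (g l *m X))) &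
  (forall a X, \tr (rho *m (X *m g a)) = I1 * \sum_l (Gam a l)%:C%C * \tr (rho *m (X *m g l)))].

Lemma gaussian_exists : exists rho, gaussian rho.
Proof.
have [v v0 va] := gaussian_vector.
pose nv := \sum_j `|v 0 j| ^+ 2.
have nvE : nv = (complex.Re nv)%:C%C.
  by apply/esym/RRe_real/rpred_sum => j _; rewrite realX // normr_real.
have nv0 : nv != 0.
  apply: contraNneq v0 => e; apply/eqP/rowP => j; rewrite mxE.
  have /eqP := e; rewrite psumr_eq0 => [|i _]; last by rewrite exprn_ge0.
  by move=> /allP/(_ j); rewrite mem_index_enum expf_eq0 /= normr_eq0 => /(_ isT)/eqP.
have nvp : 0 <= complex.Re nv.
  have : 0 <= nv by apply: sumr_ge0 => j _; rewrite exprn_ge0.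
  by rewrite nvE lecR.
pose rho := (complex.Re nv)^-1%:C%C *: (adjmx v *m v).
have trP X : \tr (rho *m X) = nv^-1 * \tr (v *m X *m adjmx v).
  by rewrite -scalemxAl mxtraceZ -(mulmxA (adjmx v)) mxtrace_mulC [in RHS]nvE fmorphV.
exists rho; split.
- by apply: psdZ; [rewrite invr_ge0 | exact: psd_rank1].
- rewrite -[rho]mulmx1 trP mulmx1; suff -> : \tr (v *m adjmx v) = nv by rewrite mulVf.
  rewrite /mxtrace big_ord1 mxM; apply: eq_bigr => j _.
  by rewrite adjmxE normCK.
- move=> a X; rewrite trP.
  have e : v *m (g a *m X) = \sum_l (- I1 * (Gam a l)%:C%C) *: (v *m (g l *m X)).
    have : v *m g a = - (I1 *: (v *m lincomb g (Gam a))).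
      by apply/eqP; rewrite -addr_eq0 scalemxAr -mulmxDr; apply/eqP/va.
    rewrite mulmxA => ->; rewrite /lincomb mulmx_sumr scaler_sumr -sumrN mulmx_suml.
    apply: eq_bigr => l _.
    by rewrite -scalemxAr scalerA -scaleNr -scalemxAl mulNr mulmxA.
  rewrite e mulmx_suml (raddf_sum (@mxtrace C 1)) !mulr_sumr; apply: eq_bigr => l _.
  by rewrite trP -scalemxAl /= mxtraceZ; ring.
move=> a X; rewrite trP.
have e : (X *m g a) *m adjmx v = \sum_l (I1 * (Gam a l)%:C%C) *: ((X *m g l) *m adjmx v).
  have : g a *m adjmx v = I1 *: (lincomb g (Gam a) *m adjmx v).
    have := congr1 (@adjmx R _ _) (va a).
    rewrite adjmx0 adjmxM adjmxD adjmxZ (adjmx_lincomb hg) conj_i.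
    case: hg => -> _; rewrite mulmxDl scaleNr mulNmx -scalemxAl => /eqP.
    by rewrite subr_eq0 => /eqP.
  rewrite -mulmxA => ->; rewrite /lincomb mulmx_suml scaler_sumr mulmx_sumr.
  by apply: eq_bigr => l _; rewrite -scalemxAl scalerA -scalemxAr mulmxA.
rewrite -mulmxA e mulmx_sumr (raddf_sum (@mxtrace C 1)) !mulr_sumr; apply: eq_bigr => l _.
by rewrite trP -scalemxAr /= mxtraceZ !mulmxA; ring.
Qed.

End Gaussian.

(** * Parity of Pfaffians of sign matrices *)

Definition odd_int (z : int) := exists m : int, z = 2 * m + 1.

Lemma odd_int_sgn (b : bool) z : odd_int z -> odd_int ((-1) ^+ b * z).
Proof. by case=> m ->; case: b; [exists (- m - 1) | exists m]; ring. Qed.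

Lemma odd_int_sum (T : eqType) (s : seq T) (F : T -> int) : odd (size s) ->
  (forall x, x \in s -> odd_int (F x)) -> odd_int (\sum_(x <- s) F x).
Proof.
move=> os hF.
have [m ->] : exists m : int, \sum_(x <- s) F x = 2 * m + (size s)%:R.
  elim: s hF {os} => [|x s IH] hF; first by exists 0; rewrite big_nil.
  have [m e] := IH (fun y ys => hF y (mem_behead (s := x :: s) ys)).
  have [m' e'] := hF x (mem_head _ _).
  by exists (m + m'); rewrite big_cons e e' /= -addn1 natrD; ring.
exists (m + ((size s)./2)%:R).
rewrite -{1}(odd_double_half (size s)) os natrD -muln2 natrM /=; ring.
Qed.

Lemma odd_int_sqr z : odd_int z -> 1 <= z ^+ 2.
Proof. by case=> m ->; nia. Qed.

Section Pfaffian.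
Variables (R : realType) (M d : nat) (g : 'I_M -> 'M[R[i]]_d).
Local Notation C := R[i].
Local Notation I1 := (Complex 0 1 : C).
Hypothesis hg : majorana g.

(** The sign is left unspecified because only the parity of the resulting integers is tracked. *)
Lemma g_gprod_rem l (s : seq 'I_M) : uniq s -> l \in s ->
  exists b : bool, g l *m gprod g s = (-1) ^+ b *: gprod g (rem l s).
Proof.
elim: s => //= x s IH /andP[xs us]; rewrite inE.
have [->|lx] /= := eqVneq x l.
  by exists false; rewrite mulmxA (g_sqr hg) mul1mx scale1r.
move=> ls; have [b e] := IH us ls.
exists (~~ b); rewrite mulmxA (g_anti hg (_ : l != x)) 1?eq_sym //.
rewrite mulNmx -mulmxA e -scalemxAr -scaleNr.
by case: b {e}; rewrite ?expr1 ?expr0 ?opprK.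
Qed.

Variables (Gam : 'I_M -> 'I_M -> R) (c : R) (sg : 'I_M -> 'I_M -> bool) (rho : 'M[C]_d).
Hypothesis hGam : forall a b, a != b -> Gam a b = (-1) ^+ sg a b * c.
Hypothesis hrho : gaussian g Gam rho.

(** [g a] anticommutes with the odd product X, so the left and right relations of the state can be
    averaged; this produces g_l X + X g_l, which is 2 g_l X for l in s and 0 otherwise. *)
Lemma wick a s : uniq (a :: s) -> odd (size s) ->
  \tr (rho *m gprod g (a :: s)) =
  - I1 * \sum_(l <- s) (Gam a l)%:C%C * \tr (rho *m (g l *m gprod g s)).
Proof.
case: hrho => _ _ hl hr /= /andP[nas us] os.
set X := gprod g s.
have e1 := hl a X; have e2 := hr a X.
have aX : X *m g a = - (g a *m X).
  rewrite (g_gprod hg a s) (count_memPn nas) addn0 -/X.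
  by rewrite -signr_odd os expr1 scaleN1r opprK.
rewrite aX mulmxN raddfN /= in e2.
have e3 : \tr (rho *m (g a *m X)) = - I1 * \sum_l (Gam a l)%:C%C * \tr (rho *m (X *m g l)).
  by rewrite mulNr -e2 opprK.
have e4 l : \tr (rho *m (g l *m X)) + \tr (rho *m (X *m g l)) =
    if l \in s then 2%:R * \tr (rho *m (g l *m X)) else 0.
  have := g_gprod hg l s; rewrite -/X count_uniq_mem //.
  rewrite -signr_odd oddD os; case: (l \in s) => /=.
    by rewrite scale1r => <-; rewrite mulr_natl mulr2n.
  by rewrite scaleN1r => ->; rewrite mulmxN raddfN /= addNr.
have : 2%:R * \tr (rho *m (g a *m X)) = 2%:R * (- I1 * \sum_(l <- s) (Gam a l)%:C%C * \tr (rho *m (g l *m X))).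
  rewrite mulr_natl mulr2n {1}e1 e3 -mulrDr -big_split /= mulrCA; congr (_ * _).
  under eq_bigr => l _ do rewrite -mulrDr e4.
  rewrite [in RHS]big_uniq // [in RHS]big_mkcond /= mulr_sumr; apply: eq_bigr => l _.
  by case: (l \in s); rewrite ?mulr0 // mulrCA.
by apply: (mulfI (two_neq0 R)).
Qed.

(* The Pfaffian of a matrix with entries +-1 is a sum of an odd number, (2k-1)!!, of terms +-1. *)
Lemma trace_gprod_odd k s : uniq s -> size s = (2 * k)%N ->
  exists2 z : int, odd_int z & \tr (rho *m gprod g s) = (- I1 * c%:C%C) ^+ k * z%:~R.
Proof.
elim: k s => [|k IH] s us ss.
  case: s us ss => // _ _; exists 1; first by exists 0.
  by rewrite /= mulmx1; case: hrho => _ -> _ _; rewrite mul1r.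
case: s us ss => // a s us; rewrite mulnS => -[ss].
have os : odd (size s) by rewrite ss /= oddM.
have /andP[nas us'] : (a \notin s) && uniq s := us.
have term l : exists z : int, l \in s -> odd_int z /\
    (Gam a l)%:C%C * \tr (rho *m (g l *m gprod g s)) = c%:C%C * (- I1 * c%:C%C) ^+ k * z%:~R.
  case: (boolP (l \in s)) => ls; last by exists 0.
  have [b e] := g_gprod_rem us' ls.
  have [z oz ez] := IH (rem l s) (rem_uniq l us') ltac:(by rewrite size_rem // ss).
  exists ((-1) ^+ sg a l * ((-1) ^+ b * z)) => _; split.
    by do 2!apply: odd_int_sgn.
  rewrite e -scalemxAr mxtraceZ ez hGam; last by apply: contraNneq nas => ->.
  rewrite !rmorphM !rmorphXn !rmorphN1 /=; ring.
have [z hz] := fin_all_exists term.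
exists (\sum_(l <- s) z l); first by apply: odd_int_sum => // l /hz[].
rewrite wick // exprS rmorph_sum /= -mulrA -[in RHS]mulrA; congr (_ * _).
rewrite !mulr_sumr; apply: eq_big_seq => l /hz[_ ->]; ring.
Qed.

End Pfaffian.

(** A = H - I is skew with A A^T = (M - 1) I, so A / sqrt (M - 1) is an admissible [Gam] with
    off-diagonal entries +-c, and traces of 2k generators are, up to phase, c^k times odd integers.
    The map t places the M generators among the N given ones. *)
Lemma skew_hadamard_state (R : realType) M N d (H : 'M[int]_M) (g : 'I_N -> 'M[R[i]]_d)
    (t : 'I_M -> 'I_N) :
  skew_hadamard H -> (1 < M)%N -> (0 < d)%N -> majorana g -> injective t ->
  exists rho : 'M[R[i]]_d, [/\ psd rho, \tr rho = 1 &
    forall (S : {set 'I_N}) k, #|S| = (2 * k)%N -> {subset S <= codom t} ->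
      (Num.sqrt (M.-1)%:R)^-1 ^+ k <= `|ev rho (gset g S)|].
Proof.
move=> [[Hpm HH] Hskew] M1 d0 hg ti.
pose c : R := (Num.sqrt (M.-1)%:R)^-1.
have M0 : (0 : R) < (M.-1)%:R by rewrite ltr0n; case: (M) M1 => [|[]].
have cc : c * c = ((M.-1)%:R)^-1 by rewrite -invfM -expr2 sqr_sqrtr // ltW.
have c0 : 0 <= c by rewrite invr_ge0 sqrtr_ge0.
have Hs a b : H a b + H b a = 2 * (a == b)%:R.
  by have /matrixP/(_ a b) := Hskew; rewrite !mxE; case: (a == b).
have Ho a b : \sum_l H a l * H b l = M%:R * (a == b)%:R.
  have /matrixP/(_ a b) := HH; rewrite mxM mxE => e.
  transitivity (M%:R *+ (a == b) : int); last by case: (a == b); rewrite ?mulr1 ?mulr0.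
  by rewrite -e; apply: eq_bigr => l _; rewrite mxE.
pose A a b : int := H a b - (a == b)%:R.
have Aanti a b : A a b = - A b a.
  by have := Hs a b; rewrite /A [b == a]eq_sym => h; lia.
have Aorth a b : \sum_l A a l * A b l = (M%:R - 1) * (a == b)%:R.
  have pick (i : 'I_M) (f : 'I_M -> int) : \sum_l (i == l)%:R * f l = f i.
    rewrite (bigD1 i) //= eqxx mul1r big1 ?addr0 // => l /negbTE.
    by rewrite eq_sym => ->; rewrite mul0r.
  have e l : A a l * A b l = H a l * H b l - (b == l)%:R * H a l - (a == l)%:R * H b l
     + (a == l)%:R * (b == l)%:R by rewrite /A; ring.
  under eq_bigr => l _ do rewrite e.
  rewrite !big_split !sumrN /= !pick Ho [b == a]eq_sym.
  by have := Hs a b; lia.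
pose Gam a b : R := c * (A a b)%:~R.
have Ganti a b : Gam a b = - Gam b a by rewrite /Gam Aanti rmorphN mulrN.
have Gorth a b : \sum_l Gam a l * Gam b l = (a == b)%:R.
  transitivity (c * c * (\sum_l A a l * A b l)%:~R).
    by rewrite rmorph_sum mulr_sumr; apply: eq_bigr => l _; rewrite /Gam /= rmorphM; ring.
  have eM : (M%:R - 1 : int) = (M.-1)%:R by rewrite -{1}(ltn_predK M1) -natr1 addrK.
  rewrite Aorth cc eM rmorphM !rmorph_nat.
  by rewrite mulrA mulVf ?mul1r // gt_eqF.
have hGam a b : a != b -> Gam a b = (-1) ^+ (H a b == -1) * c.
  move=> ab; rewrite /Gam /A (negbTE ab) subr0.
  by case: (Hpm a b) => ->; rewrite ?rmorphN1 ?rmorph1 ?eqxx /= ?expr1 ?expr0 ?mulr1 ?mul1r ?mulrN1 ?mulN1r.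
pose g' a := g (t a).
have hg' : majorana g'.
  by case: hg => h1 h2; split => [j|j k]; rewrite /g' ?h1 // h2 (inj_eq ti).
have [rho hrho] := gaussian_exists hg' d0 Ganti Gorth.
have [pr tr1 _ _] := hrho.
exists rho; split=> // S k cS sub.
(* The list s may fail to be sorted; the parity argument only asks for distinct entries. *)
have [s es] : exists s, enum S = map t s.
  have : {subset enum S <= codom t} by move=> x; rewrite mem_enum; exact: sub.
  elim: (enum S) => [|x e IH] he; first by exists [::].
  have [s ->] := IH (fun y ye => he y (mem_behead (s := x :: e) ye)).
  by have /codomP[a ->] := he x (mem_head _ _); exists (a :: s).
have us : uniq s by rewrite -(map_inj_uniq ti) -es enum_uniq.
have ss : size s = (2 * k)%N by rewrite -cS cardE es size_map.
have gs : gprod g (enum S) = gprod g' s by rewrite es; elim: (s) => //= a s' ->.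
have [z oz ez] := trace_gprod_odd hg' hGam hrho us ss.
set x := ev rho (gset g S).
have xE : x%:C%C = Complex 0 1 ^+ 'C(#|S|, 2) * ((- Complex 0 1 * c%:C%C) ^+ k * z%:~R).
  rewrite -ez -gs -mxtraceZ scalemxAr -gsetE; apply/esym/realC_Re.
  rewrite -mxtrace_adjmx adjmxM (adjmx_gset hg).
  by case: pr => -> _; rewrite mxtrace_mulC.
(* As x is real, its square is x times its conjugate, which removes all phases. *)
have x2 : x ^+ 2 = (c ^+ k * z%:~R) ^+ 2.
  apply: (@complexI R); rewrite expr2 rmorphM /= -{2}(conj_realC x) xE.
  rewrite !rmorphM !rmorphXn !rmorphM !rmorphN /= conj_i conj_realC rmorph_int.
  rewrite ?rmorph_int /=.
  have -> : Complex 0 1 ^+ 'C(#|S|, 2) * ((- Complex 0 1 * c%:C%C) ^+ k * z%:~R) *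
      ((- Complex 0 1) ^+ 'C(#|S|, 2) * ((- - Complex 0 1 * c%:C%C) ^+ k * z%:~R)) =
      (Complex 0 1 * - Complex 0 1) ^+ 'C(#|S|, 2) * ((- Complex 0 1 * - - Complex 0 1) * (c%:C%C * c%:C%C)) ^+ k * z%:~R ^+ 2 :> R[i].
    by rewrite !exprMn; ring.
  rewrite opprK mulrN mulNr i_sqr opprK expr1n mul1r mul1r exprMn.
  by rewrite expr2 mulrACA.
have z1 : 1 <= (z%:~R : R) ^+ 2 by rewrite -rmorphXn ler1z odd_int_sqr.
rewrite -/c -(ger0_norm (exprn_ge0 k c0)) -sqrtr_sqr -[leRHS]sqrtr_sqr.
apply: ler_wsqrtr; rewrite x2 exprMn -[leLHS]mulr1 ler_wpM2l ?sqr_ge0 //.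
Qed.

(** * Skew-Hadamard matrices of size a power of two *)

Lemma skew_hadamard_comm m (H : 'M[int]_m) : skew_hadamard H -> H^T *m H = (m%:R)%:M.
Proof.
move=> [[_ HH] Hs]; rewrite -HH.
have -> : H^T = 2%:M - H by rewrite -Hs addrC addKr.
by rewrite mulmxBl mulmxBr mul_scalar_mx mul_mx_scalar.
Qed.

(** The off-diagonal blocks cancel against those of the transpose. The lower right block of the
    product requires H^T H = m I, which holds because H^T = 2 I - H commutes with H. *)
Lemma skew_hadamard_double m (H : 'M[int]_m) : skew_hadamard H ->
  skew_hadamard (block_mx H H (- H^T) H^T).
Proof.
move=> sH; have HtH := skew_hadamard_comm sH; case: sH => [[Hpm HH] Hs].
split; first split.
- move=> i j; rewrite mxE; case: split => a; rewrite mxE; case: split => b //.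
    by rewrite !mxE; case: (Hpm b a) => ->; [right | left].
  by rewrite mxE.
- rewrite tr_block_mx linearN /= !trmxK mulmx_block !mulmxN !mulNmx opprK !addNr.
  by rewrite HH HtH natrD -raddfD /= scalar_mx_block.
rewrite tr_block_mx linearN /= !trmxK add_block_mx Hs subrr addNr addrC -Hs scalar_mx_block.
by rewrite -Hs addrC.
Qed.

Lemma skew_hadamard_pow2 r : exists H : 'M[int]_(2 ^ r), skew_hadamard H.
Proof.
elim: r => [|r [H hH]].
  exists 1%:M; split; first split.
  - by move=> i j; rewrite !ord1 mxE; left.
  - by rewrite mul1mx trmx1.
  by rewrite trmx1 -raddfD.
by rewrite expnS mul2n -addnn; exists (block_mx H H (- H^T) H^T); apply: skew_hadamard_double.
Qed.

(** * Covering all index sets by boundedly many states *)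

Lemma injection_cover N M (B : {set 'I_N}) : (M <= N)%N ->
  exists2 t : 'I_M -> 'I_N, injective t & ((#|B| <= M)%N -> {subset B <= codom t}).
Proof.
case: N B => [|N] B MN.
  exists (fun i => Ordinal (leq_trans (ltn_ord i) MN)) => [i|_ [] //].
  by have := leq_trans (ltn_ord i) MN.
(* B is listed first, so the first M positions contain all of it once #|B| <= M. *)
pose l := enum B ++ enum (~: B).
have ul : uniq l.
  rewrite cat_uniq !enum_uniq andbT /=; apply/hasPn => x.
  by rewrite !mem_enum !inE.
have sl : size l = N.+1 by rewrite size_cat -!cardE cardsC card_ord.
have lt (i : 'I_M) : (i < size l)%N by rewrite sl; apply: leq_trans MN.
exists (fun i : 'I_M => nth ord0 l i) => [i j /eqP|BM x xB].
  by rewrite nth_uniq // => /eqP/val_inj.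
have xl : (index x l < #|B|)%N by rewrite /l index_cat mem_enum xB cardE index_mem mem_enum.
apply/codomP; exists (Ordinal (leq_trans xl BM)) => /=; rewrite nth_index //.
by rewrite /l mem_cat mem_enum xB.
Qed.

(** An index is determined by its quotient and remainder modulo s, so each colour class has at most
    s elements. *)
Lemma card_preim_div N Q s (c : 'I_N -> 'I_Q) (A : {set 'I_Q}) :
  (0 < s)%N -> (forall x, c x = (x %/ s)%N :> nat) -> (#|c @^-1: A| <= #|A| * s)%N.
Proof.
move=> s0 cE; pose f (x : 'I_N) := (c x, Ordinal (ltn_pmod x s0)).
have fi : injective f.
  move=> x y [/(congr1 val) /= e1 e2]; apply: val_inj; rewrite /= !cE in e1.
  by rewrite /= (divn_eq x s) (divn_eq y s) e1 e2.
rewrite -(card_imset _ fi) -[s in leqRHS]card_ord -cardsT -cardsX.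
apply: subset_leq_card; apply/fintype.subsetP => _ /imsetP[x xA ->].
by rewrite !inE /= andbT; rewrite inE in xA.
Qed.

Section Lower.
Variable R : realType.

Lemma eta2_ge n (g : 'I_(2 * n) -> 'M[R[i]]_(2 ^ n)) (H : 'M[int]_(2 * n)) :
  (1 <= n)%N -> is_majorana g -> skew_hadamard H ->
  1 / Num.sqrt ((2 * n).-1)%:R <= eta_star g 2.
Proof.
move=> n1 hg sH; have hg' : majorana g := hg.
have n2 : (1 < 2 * n)%N by lia.
have d0 : (0 < 2 ^ n)%N by rewrite expn_gt0.
have [rho [pr tr1 hS]] := skew_hadamard_state sH n2 d0 hg' (@inj_id _).
have s1 : 1 <= Num.sqrt ((2 * n).-1%:R : R).
  by rewrite -[leLHS]sqrtr1 ler_wsqrtr // ler1n; lia.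
have s0 : 0 < Num.sqrt ((2 * n).-1%:R : R) by apply: lt_le_trans s1.
apply: eta_star_ge; first by rewrite div1r invr_ge0 (ltW s0) invf_le1.
apply: (@jm_of_states _ _ _ hg _ unit (fun=> rho)) => //.
- by rewrite card_unit.
- by rewrite div1r invr_ge0 ltW.
move=> S cS; rewrite card_unit mulr1 (big_pred1 tt) => [|[]//].
have := hS S 1%N cS; rewrite expr1 div1r; apply => x _.
by apply/codomP; exists x.
Qed.

(* Colour [2n] by blocks of s consecutive indices, where 2^(2k) s is the largest power of two that is
   at most 2n.  For each set A of at most 2k colours one Gaussian state serves all S coloured by A. *)
Lemma eta_lower n k (g : 'I_(2 * n) -> 'M[R[i]]_(2 ^ n)) :
  (1 <= k)%N -> (2 ^ (2 * k) <= n)%N -> is_majorana g ->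
  (2 ^ 2 ^ (2 * k).+1)%:R^-1 * (Num.sqrt (2 * n)%:R)^-1 ^+ k <= eta_star g (2 * k).
Proof.
move=> k1 nk hg; have hg' : majorana g := hg.
pose e := (2 * k)%N; pose L := trunc_log 2 (2 * n); pose M := (2 ^ L)%N.
have n0 : (0 < 2 * n)%N by apply: leq_trans (leq_pmull n _); rewrite // (leq_trans _ nk) ?expn_gt0.
have /andP[ML MU] : (2 ^ L <= 2 * n < 2 ^ L.+1)%N by apply: trunc_log_bounds.
have eL : (e <= L)%N by apply: trunc_log_max => //; rewrite /e; lia.
(* 2k colours occupy at most 2k s <= 2^(2k) s = M indices, so one state of size M can serve them. *)
pose s := (2 ^ (L - e))%N.
have s0 : (0 < s)%N by rewrite expn_gt0.
have Ms : M = (2 ^ e * s)%N by rewrite /M /s -expnD subnKC.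
(* Enough colours, since 2n < 2^(L+1) = 2^(2k+1) s. *)
pose Q := (2 ^ e.+1)%N.
have cQ (x : 'I_(2 * n)) : (x %/ s < Q)%N.
  rewrite ltn_divLR // /Q expnS -mulnA -Ms /M -expnS.
  exact: ltn_trans (ltn_ord x) MU.
pose c x := Ordinal (cQ x).
have tex (A : {set 'I_Q}) := injection_cover (c @^-1: A) ML.
have d0 : (0 < 2 ^ n)%N by rewrite expn_gt0.
have M1 : (1 < M)%N by rewrite -[1%N]/(2 ^ 0)%N ltn_exp2l // (leq_trans _ eL) // /e; lia.
have [H sH] := skew_hadamard_pow2 L.
have rex (A : {set 'I_Q}) : exists rho : 'M[R[i]]_(2 ^ n), [/\ psd rho, \tr rho = 1 &
    forall S : {set 'I_(2 * n)}, #|S| = (2 * k)%N -> S \subset c @^-1: A -> (#|A| <= e)%N ->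
      (Num.sqrt (M.-1)%:R)^-1 ^+ k <= `|ev rho (gset g S)|].
  have [t ti tc] := tex A.
  have [rho [pr tr1 hS]] := skew_hadamard_state sH M1 d0 hg' ti.
  exists rho; split=> // S cS SA Ae; apply: hS => // x xS; apply: tc.
    apply: leq_trans (@card_preim_div _ _ s c A s0 (fun _ => erefl)) _.
    by rewrite [leqRHS]Ms leq_mul2r (leq_trans Ae) ?orbT // ltnW // ltn_expl.
  exact: (fintype.subsetP SA).
have [rho hrho] := fin_all_exists rex.
pose cM : R := (Num.sqrt (M.-1)%:R)^-1.
have s1 : 1 <= Num.sqrt ((M.-1)%:R : R).
  by rewrite -[leLHS]sqrtr1 ler_wsqrtr // ler1n -subn1 subn_gt0.
have c0 : 0 <= cM by rewrite invr_ge0 (le_trans ler01).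
have c1 : cM <= 1 by rewrite invf_le1 // (lt_le_trans ltr01).
(* One state for every set of colours, small or not; drawing one at random costs the factor P. *)
pose P := (2 ^ 2 ^ e.+1)%N.
have cP : #|{set 'I_Q}| = P.
  have -> : #|{set 'I_Q}| = #|powerset [set: 'I_Q]|.
    by apply: eq_card => T; rewrite !inE finset.subsetT.
  by rewrite card_powerset cardsT card_ord.
have P0 : (0 < P)%N by rewrite expn_gt0.
have P0' : (0 : R) < P%:R by rewrite ltr0n.
have P1' : (1 : R) <= P%:R by rewrite ler1n.
have small : (Num.sqrt (2 * n)%:R)^-1 <= cM.
  rewrite lef_pV2 ?posrE ?(lt_le_trans ltr01) //.
    apply: ler_wsqrtr; rewrite ler_nat; apply: leq_trans ML; exact: leq_pred.
  by rewrite -[leLHS]sqrtr1 ler_wsqrtr // ler1n.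
apply: (@le_trans _ _ (P%:R^-1 * cM ^+ k)).
  rewrite ler_wpM2l ?invr_ge0 //; apply: lerXn2r; rewrite ?nnegrE ?invr_ge0 ?sqrtr_ge0 //.
have e0 : 0 <= P%:R^-1 * cM ^+ k by rewrite mulr_ge0 ?invr_ge0 ?exprn_ge0.
apply: eta_star_ge.
  rewrite e0 /= -[leRHS]mulr1 ler_pM ?invr_ge0 ?exprn_ge0 ?invf_le1 //.
  by rewrite exprn_ile1.
apply: (jm_of_states hg (rho := rho)) => //.
- by rewrite cP.
- by move=> A; case: (hrho A).
- by move=> A; case: (hrho A).
move=> S cS; rewrite cP mulrAC mulVf ?gt_eqF // mul1r.
(* Only the state attached to the colours of S is used; the other terms are nonnegative. *)
rewrite (bigD1 (c @: S)) //=; apply: ler_wpDr; first exact: sumr_ge0.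
have [_ _ h] := hrho (c @: S); apply: h => //.
  by apply/fintype.subsetP => x xS; rewrite inE imset_f.
by rewrite /e -cS leq_imset_card.
Qed.

End Lower.

(** * The upper bound in higher degree *)

Section Kernels.
Variable R : realType.

(* [krav j p q q' r], with p, q, q', r the sizes of S :&: T, S :\: T, T :\: S and of the
   complement of S :|: T, sums over sequences of j disjoint pairs {a, b} the products of
   (1_S(a) - 1_S(b)) (1_T(a) - 1_T(b)); up to a scalar this is the projection onto the j-th
   component of the Johnson scheme.  Removing one pair gives the recursion. *)
Fixpoint krav (j : nat) (p q q' r : R) : R :=
  if j is j'.+1 then
    p * r * krav j' (p - 1) q q' (r - 1) - q * q' * krav j' p (q - 1) (q' - 1) r
  else 1.

Section Counting.
Variables (N : nat) (S T : {set 'I_N}).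

Definition cell (x : 'I_N) : bool * bool := (x \in S, x \in T).

Definition cell_card (A : {set 'I_N}) (u : bool * bool) : R :=
  #|[set x in A | cell x == u]|%:R.

(** Restricting the counts to A records which points remain after some pairs have been removed. *)
Definition krav_set j (A : {set 'I_N}) : R :=
  krav j (cell_card A (true, true)) (cell_card A (true, false))
    (cell_card A (false, true)) (cell_card A (false, false)).

Lemma cell_cardD1 (A : {set 'I_N}) a u : a \in A -> cell_card (A :\ a) u = cell_card A u - (cell a == u)%:R.
Proof.
move=> aA; rewrite /cell_card (cardsD1 a [set x in A | cell x == u]) inE aA /= natrD addrAC subrr add0r.
by congr (_%:R); apply: eq_card => x; rewrite !inE andbA.
Qed.

Lemma sum_cell (A : {set 'I_N}) (F : bool * bool -> R) :
  \sum_(a in A) F (cell a) = \sum_u cell_card A u * F u.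
Proof.
rewrite (partition_big cell xpredT) //=; apply: eq_bigr => u _.
rewrite (eq_bigr (fun=> F u)) => [|a /andP[_ /eqP->] //].
rewrite sumr_const -mulr_natl /cell_card; congr (_%:R * _).
by apply: eq_card => x; rewrite !inE.
Qed.

Definition diff (a b : 'I_N) (U : {set 'I_N}) : R := (a \in U)%:R - (b \in U)%:R.

(** A pair contributes only if a and b lie in opposite cells: +1 for [S :&: T] against the outside,
    -1 for [S :\: T] against [T :\: S]. The factor 2 counts the two orders of a pair. *)
Lemma krav_setS j (A : {set 'I_N}) :
  2%:R * krav_set j.+1 A =
  \sum_(a in A) \sum_(b in A) diff a b S * diff a b T * krav_set j (A :\ a :\ b).
Proof.
pose D (u v w : bool * bool) : R := cell_card A w - (u == w)%:R - (v == w)%:R.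
pose h (u v : bool * bool) : R := ((u.1)%:R - (v.1)%:R) * ((u.2)%:R - (v.2)%:R) *
  krav j (D u v (true, true)) (D u v (true, false)) (D u v (false, true)) (D u v (false, false)).
transitivity (\sum_(a in A) \sum_(b in A) h (cell a) (cell b)); last first.
  apply: eq_bigr => a aA; apply: eq_bigr => b bA; rewrite /h /diff /=.
  have [<-|ab] := eqVneq a b; first by rewrite !subrr !mul0r.
  by rewrite /krav_set !cell_cardD1 // !inE bA eq_sym ab.
under eq_bigr => a _ do rewrite (sum_cell A (h (cell a))).
rewrite (sum_cell A (fun u => \sum_v cell_card A v * h u v)).
have sb (F : bool * bool -> R) : \sum_u F u =
    F (true, true) + F (true, false) + (F (false, true) + F (false, false)).
  transitivity (\sum_b \sum_c F (b, c)); last by rewrite !big_bool.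
  by rewrite pair_bigA; apply: eq_bigr => -[].
rewrite !sb /h /D !xpair_eqE /= !subr0 /krav_set /=.
by rewrite !(subrr, mulr0, mul0r, add0r, addr0, sub0r, subr0, mul1r, mulr1); ring.
Qed.

End Counting.

Variables (N d : nat) (g : 'I_N -> 'M[R[i]]_d) (G : 'M[R[i]]_d).
Hypotheses (hg : majorana g) (pG : psd G).

Definition corr (S T : {set 'I_N}) : R := ev G (gset g S *m gset g T).

Definition setcomb (x : {set 'I_N} -> R) : 'M[R[i]]_d := \sum_S (x S)%:C%C *: gset g S.

Lemma adjmx_setcomb x : adjmx (setcomb x) = setcomb x.
Proof.
rewrite adjmx_sum; apply: eq_bigr => S _.
by rewrite adjmxZ conj_realC (adjmx_gset hg).
Qed.

Lemma ev_setcomb_sqr x :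
  ev G (setcomb x *m setcomb x) = \sum_S \sum_T x S * x T * corr S T.
Proof.
rewrite mulmx_suml ev_sum; apply: eq_bigr => S _.
rewrite mulmx_sumr ev_sum; apply: eq_bigr => T _.
by rewrite -scalemxAl -scalemxAr scalerA -rmorphM evZ.
Qed.

(** Induction over all A and x at once: the rank-one factor [diff a b S * diff a b T] is absorbed
    into x, and the base case is positivity of [ev G (X *m X)] for a Hermitian X. *)
Lemma krav_psd j (A : {set 'I_N}) (x : {set 'I_N} -> R) :
  0 <= \sum_S \sum_T x S * x T * (krav_set S T j A * corr S T).
Proof.
elim: j A x => [|j IH] A x.
  under eq_bigr => S _ do under eq_bigr => T _ do rewrite /krav_set /= mul1r.
  by rewrite -ev_setcomb_sqr -{2}adjmx_setcomb ev_psd.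
rewrite -(pmulr_rge0 _ (ltr0Sn R 1)).
have -> : 2%:R * (\sum_S \sum_T x S * x T * (krav_set S T j.+1 A * corr S T)) =
    \sum_(a in A) \sum_(b in A) \sum_S \sum_T
      (x S * diff a b S) * (x T * diff a b T) * (krav_set S T j (A :\ a :\ b) * corr S T).
  transitivity (\sum_S \sum_T \sum_(a in A) \sum_(b in A)
      (x S * diff a b S) * (x T * diff a b T) * (krav_set S T j (A :\ a :\ b) * corr S T)).
    rewrite mulr_sumr; apply: eq_bigr => S _; rewrite mulr_sumr; apply: eq_bigr => T _.
    transitivity (x S * x T * corr S T * (2%:R * krav_set S T j.+1 A)); first by ring.
    rewrite krav_setS mulr_sumr; apply: eq_bigr => a _.
    by rewrite mulr_sumr; apply: eq_bigr => b _; ring.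
  under eq_bigr => S _ do rewrite exchange_big.
  rewrite exchange_big; apply: eq_bigr => a _ /=.
  under eq_bigr => S _ do rewrite exchange_big.
  by rewrite exchange_big.
apply: sumr_ge0 => a _; apply: sumr_ge0 => b _.
exact: (IH _ (fun S => x S * diff a b S)).
Qed.

Lemma krav_setT j (S T : {set 'I_N}) m : #|S| = m -> #|T| = m ->
  krav_set S T j finset.setT = krav j (#|S :&: T|)%:R (m%:R - (#|S :&: T|)%:R)
    (m%:R - (#|S :&: T|)%:R) (N%:R - 2%:R * m%:R + (#|S :&: T|)%:R).
Proof.
move=> cS cT; have e1 : cell_card S T finset.setT (true, true) = (#|S :&: T|)%:R.
  congr (_%:R); apply: eq_card => x; rewrite !inE /cell xpair_eqE.
  by case: (x \in S); case: (x \in T).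
have e2 : cell_card S T finset.setT (true, false) = m%:R - (#|S :&: T|)%:R.
  rewrite -cS -(cardsID T S) natrD addrAC subrr add0r.
  congr (_%:R); apply: eq_card => x; rewrite !inE /cell xpair_eqE.
  by case: (x \in S); case: (x \in T).
have e3 : cell_card S T finset.setT (false, true) = m%:R - (#|S :&: T|)%:R.
  rewrite -cT -(cardsID S T) finset.setIC natrD addrAC subrr add0r.
  congr (_%:R); apply: eq_card => x; rewrite !inE /cell xpair_eqE.
  by case: (x \in S); case: (x \in T).
have e4 : cell_card S T finset.setT (false, false) = N%:R - 2%:R * m%:R + (#|S :&: T|)%:R.
  have -> : cell_card S T finset.setT (false, false) = (#|~: (S :|: T)|)%:R.
    congr (_%:R); apply: eq_card => x; rewrite !inE /cell xpair_eqE.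
    by case: (x \in S); case: (x \in T).
  have h1 : (#|S :|: T| + #|~: (S :|: T)|)%:R = N%:R :> R by rewrite cardsC card_ord.
  have h2 : (#|S :|: T| + #|S :&: T|)%:R = m%:R + m%:R :> R by rewrite cardsUI cS cT natrD.
  by move: h1 h2; rewrite !natrD; lra.
by rewrite /krav_set e1 e2 e3 e4.
Qed.

(* Dual certificate for the Lovasz theta function of the commutation graph of the [gset S],
   |S| = m: entries at odd intersections are free because there [corr] vanishes. *)
Lemma kernel_bound (w : nat -> R) (J m : nat) (t : R) (a : {set 'I_N} -> R) :
  ~~ odd m -> 0 <= t -> (forall i, (i < J)%N -> 0 <= w i) ->
  (forall p, (p <= m)%N -> ~~ odd p ->
    \sum_(i < J) w i * krav (2 * i).+1 p%:R (m%:R - p%:R) (m%:R - p%:R) (N%:R - 2%:R * m%:R + p%:R) =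
      t * (p == m)%:R - 1) ->
  (forall S, `|a S| <= 1) ->
  \sum_(S : {set 'I_N} | #|S| == m) a S * ev G (gset g S) <=
    Num.sqrt (t * ('C(N, m))%:R) * ev G 1%:M.
Proof.
move=> om t0 w0 hw a1; set tau := ev G 1%:M.
have tau0 : 0 <= tau by exact: ev1_ge0.
pose x (S : {set 'I_N}) := if #|S| == m then a S else 0.
pose X := setcomb x.
have evX : ev G X = \sum_(S : {set 'I_N} | #|S| == m) a S * ev G (gset g S).
  rewrite ev_sum [RHS]big_mkcond; apply: eq_bigr => S _; rewrite evZ /x.
  by case: ifP => // _; rewrite mul0r.
have x2 : \sum_S x S ^+ 2 <= ('C(N, m))%:R.
  rewrite -[in leRHS](card_ord N) -card_draws -sum1_card natr_sum [leRHS]big_mkcond /=.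
  apply: ler_sum => S _; rewrite inE /x; case: ifP => _; last by rewrite expr0n.
  by rewrite -real_normK ?num_real // expr_le1.
(* The difference of the two sides is the combination, with weights w, of the nonnegative forms of
   [krav_psd]. *)
have key : ev G (X *m X) <= t * tau * \sum_S x S ^+ 2.
  rewrite ev_setcomb_sqr -subr_ge0.
  have -> : t * tau * (\sum_S x S ^+ 2) - \sum_S \sum_T x S * x T * corr S T =
      \sum_(i < J) w i * \sum_S \sum_T x S * x T * (krav_set S T (2 * i).+1 finset.setT * corr S T).
    under [RHS]eq_bigr => i _ do rewrite mulr_sumr.
    rewrite [RHS]exchange_big /= [X in X - _]mulr_sumr -sumrB; apply: eq_bigr => S _.
    under [RHS]eq_bigr => i _ do rewrite mulr_sumr.
    rewrite [RHS]exchange_big /=.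
    have -> : t * tau * x S ^+ 2 = \sum_T (S == T)%:R * (t * tau * x S ^+ 2).
      rewrite (bigD1 S) //= eqxx mul1r big1 ?addr0 // => T.
      by rewrite eq_sym => /negbTE->; rewrite mul0r.
    rewrite -sumrB; apply: eq_bigr => T _.
    have [cS|cS] := eqVneq #|S| m; last first.
      rewrite /x (negbTE cS) expr0n !mulr0 !mul0r subr0 big1 // => i _.
      by rewrite !mul0r mulr0.
    have [cT|cT] := eqVneq #|T| m; last first.
      have -> : (S == T) = false by apply: contraNF cT => /eqP <-; rewrite cS.
      rewrite /x (negbTE cT) !mulr0 !mul0r subr0 big1 // => i _.
      by rewrite !mul0r mulr0.
    under eq_bigr => i _ do rewrite (krav_setT _ cS cT).
    set p := #|S :&: T|.
    transitivity (x S * x T * corr S T * (t * (p == m)%:R - 1)); last first.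
      (* As m is even, operators with odd intersection anticommute, while [corr] is symmetric; so it
         vanishes there. *)
      have [op|op] := boolP (odd p).
        suff -> : corr S T = 0.
          by rewrite !mulr0 mul0r big1 // => i _; rewrite !mulr0.
        have e1 : corr S T = corr T S.
          by rewrite /corr -(ev_adjmx _ (proj1 pG)) adjmxM !(adjmx_gset hg).
        have e2 : corr S T = - corr T S.
          rewrite /corr (gset_comm hg S T) cS cT -/p -signr_odd oddD oddM (negbTE om) op.
          by rewrite /= expr1 scaleN1r evN.
        by rewrite -e1 in e2; lra.
      rewrite -hw // ?mulr_sumr; first by apply: eq_bigr => i _; ring.
      by rewrite -cS subset_leq_card ?finset.subsetIl.
    have -> : (p == m) = (S == T).
      apply/eqP/eqP => [pm|ST]; last by rewrite /p -ST finset.setIid.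
      have : S \subset T by apply/finset.setIidPl/eqP; rewrite eqEcard finset.subsetIl cS -pm leqnn.
      by move=> ST; apply/eqP; rewrite eqEcard ST cS cT leqnn.
    have [<-|_] := eqVneq S T; last by rewrite mul0r mulr0 !sub0r mulrN1.
    by rewrite /corr (gset_sqr hg) -/tau; ring.
  by apply: sumr_ge0 => i _; rewrite mulr_ge0 ?w0 // krav_psd.
rewrite -evX.
have q s : 0 <= ev G (X *m X) - 2%:R * s * ev G X + s ^+ 2 * tau.
  have := ev_psd (X - (s%:C%C)%:M) pG.
  have -> : adjmx (X - (s%:C%C)%:M) = X - (s%:C%C)%:M.
    rewrite -scalemx1 -scaleNr adjmxD adjmxZ adjmx1 adjmx_setcomb.
    by rewrite -rmorphN /= conj_realC.
  have -> : (X - (s%:C%C)%:M) *m (X - (s%:C%C)%:M) =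
      X *m X - (2%:R * s)%:C%C *: X + ((s ^+ 2)%:C%C)%:M.
    have -> : (2%:R * s)%:C%C *: X = s%:C%C *: X + s%:C%C *: X.
      by rewrite -scalerDl -rmorphD; congr (_%:C%C *: _); ring.
    have -> : (s ^+ 2)%:C%C = s%:C%C * s%:C%C by rewrite expr2 rmorphM.
    rewrite mulmxBl !mulmxBr mul_mx_scalar (mul_scalar_mx _ X) scalar_mxM.
    by rewrite opprB opprD !addrA [LHS]addrAC.
  by rewrite evD evD evN evZ evC.
have bX : ev G (X *m X) <= t * ('C(N, m))%:R * tau.
  apply: le_trans key _; rewrite mulrAC ler_wpM2r // ler_wpM2l //.
set B := t * _ in bX *.
have B0 : 0 <= B by rewrite mulr_ge0.
have sB := sqr_sqrtr B0.
(* For B = 0, a positive [ev G X] is refuted by s = 1 if tau = 0 and by s = [ev G X / tau]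
   otherwise. *)
have [Bz|Bz] := eqVneq B 0.
  rewrite Bz sqrtr0 mul0r leNgt; apply/negP => y0.
  have [tz|tz] := eqVneq tau 0.
    by have := q 1; rewrite tz mulr0 in bX *; move: y0 bX; lra.
  have tp : 0 < tau by rewrite lt_def tz.
  have e : (ev G X / tau) ^+ 2 * tau = ev G X * ev G X / tau by field.
  have := q (ev G X / tau); rewrite e; rewrite Bz mul0r in bX.
  have -> : 2%:R * (ev G X / tau) * ev G X = 2%:R * (ev G X * ev G X / tau) by field.
  have : 0 < ev G X * ev G X / tau by rewrite divr_gt0 ?mulr_gt0.
  by lra.
have Bp : 0 < Num.sqrt B by rewrite sqrtr_gt0 lt_def Bz.
(* This s balances the terms, since [ev G (X *m X)] is at most B tau. *)
have := q (Num.sqrt B); rewrite sB => h.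
rewrite -(ler_pM2l Bp) mulrA -expr2 sB.
by lra.
Qed.

End Kernels.

(** * Certificates for the weights: integer polynomials in n *)

Section IntegerPolynomials.
Import BinInt.
Local Open Scope Z_scope.

(** Polynomials are coefficient lists over binary integers, constant term first, so that the checks
    run by [vm_compute]. *)
Definition padd (p q : seq Z) : seq Z :=
  (fix add p q := match p, q with
   | [::], _ => q
   | _, [::] => p
   | a :: p', b :: q' => Z.add a b :: add p' q' end) p q.

Definition pscale (c : Z) (p : seq Z) : seq Z := [seq Z.mul c a | a <- p].

Fixpoint pmul (p q : seq Z) : seq Z :=
  if p is a :: p' then padd (pscale a q) (0 :: pmul p' q) else [::].

(** For fixed k and intersection size, only the count r of points outside both sets depends on n; it
    alone is a polynomial. *)
Fixpoint kravP (j : nat) (p q q' : Z) (r : seq Z) : seq Z :=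
  if j is j'.+1 then
    padd (pmul r (pscale p (kravP j' (Z.sub p 1) q q' (padd r [:: -1]))))
         (pscale (Z.opp (Z.mul q q')) (kravP j' p (Z.sub q 1) (Z.sub q' 1) r))
  else [:: 1].

Fixpoint ffactP (k : nat) : seq Z :=
  if k is k'.+1 then pmul (ffactP k') [:: Z.opp (Z.of_nat k'); 1] else [:: 1].

Definition cert_sum (k p : nat) (Ds : seq (seq Z)) : seq Z :=
  let q := Z.of_nat (2 * k - p) in
  let r := [:: Z.sub (Z.of_nat p) (Z.of_nat (4 * k)); 2] in
  foldr padd [::] [seq pmul (nth [::] Ds i) (kravP (2 * i).+1 (Z.of_nat p) q q r) | i <- iota 0 k].

Definition is_zeroP (p : seq Z) := all (Z.eqb 0) p.

(* For [cert = (D, [:: D_0; D_1; ...])] the weights are [w_i = D_i(n) / D(n)]. *)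
Definition check_cert (k : nat) (cert : seq Z * seq (seq Z)) : bool :=
  let: (D, Ds) := cert in
  [&& size Ds == k, Z.ltb 0 (last 0 D), all (fun d => Z.ltb 0 (last 0 d)) Ds,
      all (fun i => is_zeroP (padd (cert_sum k (2 * i) Ds) D)) (iota 0 k) &
      is_zeroP (padd (pscale (Z.of_nat k`!) (padd (cert_sum k (2 * k) Ds) D))
                     (pscale (-1) (pmul D (ffactP k))))].

(* The weights solve, by Cramer's rule over the rational functions in n, the linear system
   asking that the kernel takes the value -1 at intersections 0, 2, ..., 2k-2. *)
Definition cert1 : seq Z * seq (seq Z) := ([:: 4],
  [:: [:: 1]]).

Definition cert2 : seq Z * seq (seq Z) := ([:: 2304; -2112; 384],
  [:: [:: 144; -168; 24];
  [:: 0; 1]]).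

Definition cert3 : seq Z * seq (seq Z) := ([:: 972518400; -1789378560; 1270759680; -448462080; 83197440; -7695360; 276480],
  [:: [:: 27014400; -59112960; 45871680; -16457280; 2922240; -245760; 7680];
  [:: 0; 24600; -28340; 10900; -1600; 80];
  [:: 0; -30; 53; -25; 2]]).

Definition cert4 : seq Z * seq (seq Z) := ([:: 33249853911859200; -78136416487342080; 77673833181020160; -43275006929387520; 15023392185876480;
    -3403288400117760; 509804511068160; -49819820359680; 3031919493120; -103301775360; 1486356480],
  [:: [:: 519528967372800; -1430793420779520; 1578648847749120; -935985039897600; 334164333081600;
    -75627150197760; 11032884495360; -1025731123200; 58089830400; -1803755520; 23224320];
  [:: 0; 129170764800; -232040229120; 170064478080; -66086334720; 14855191680; -1980545280; 153457920;
    -6343680; 107520];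
  [:: 0; -26236224; 64984248; -59119200; 25315248; -5532576; 621432; -33600; 672];
  [:: 0; 22320; -60198; 60383; -27950; 5905; -472; 12]]).

Definition cert5 : seq Z * seq (seq Z) := ([:: 435517628100194716876800000; -1258505416577266803671040000; 1621505209079378925453312000;
    -1243378748244220989249945600; 637693143374512623373516800; -232645146805303977546547200;
    62587022784922407518208000; -12683619233010635548262400; 1958530072100279589273600;
    -231270743960573829120000; 20809850963830574284800; -1410729646317207552000; 70535891893262745600;
    -2509321573682380800; 59724686897971200; -846331379712000; 5350883328000],
  [:: [:: 4355176281001947168768000; -14502883643830136320819200; 20709000634483313969725440;
    -17094151234295878055362560; 9225052287780471310909440; -3476418772414982221578240;
    951207358279207065845760; -193459389499666498682880; 29627914359142136217600;
    -3432828996612601528320; 300063577811176488960; -19572691396587356160; 932906261832007680;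
    -31348801001226240; 698450800803840; -9185683046400; 53508833280];
  [:: 0; 413498589682913280000; -1003331103359219712000; 1075249685061338572800;
    -674967088304023173120; 277570025114534208000; -79221895145984747520; 16209051827523609600;
    -2418752453661895680; 264837632929390080; -21191024417633280; 1220131707540480; -49009005158400;
    1296985374720; -20205158400; 139345920];
  [:: 0; -26345286219571200; 82999850194759680; -107907637104400896; 77360487930206208;
    -34511122293282432; 10214072232336000; -2079011521004544; 296386327673856; -29720142345600;
    2075944526208; -98280967680; 2983550976; -51867648; 387072];
  [:: 0; 4235633700480; -14440137108192; 20425300219440; -15818917405896; 7459091973900;
    -2255945958864; 449783249112; -59798612232; 5282668044; -303264000; 10747296; -210816; 1728];
  [:: 0; -2460235680; 8665052472; -12707222220; 10195687466; -4937797691; 1501208034; -289177854;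
    34970370; -2595159; 112834; -2596; 24]]).

Lemma check_cert1 : check_cert 1 cert1. Proof. by vm_compute. Qed.
Lemma check_cert2 : check_cert 2 cert2. Proof. by vm_compute. Qed.
Lemma check_cert3 : check_cert 3 cert3. Proof. by vm_compute. Qed.
Lemma check_cert4 : check_cert 4 cert4. Proof. by vm_compute. Qed.
Lemma check_cert5 : check_cert 5 cert5. Proof. by vm_compute. Qed.

End IntegerPolynomials.

(** * Soundness of the certificates *)

Section CertificateSoundness.
Variable R : realType.

Definition zr (c : BinNums.Z) : R := (int_of_Z c)%:~R.

Lemma zrD a b : zr (BinInt.Z.add a b) = zr a + zr b.
Proof. by rewrite /zr -rmorphD; congr (_%:~R); lia. Qed.

Lemma zrM a b : zr (BinInt.Z.mul a b) = zr a * zr b.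
Proof. by rewrite /zr -rmorphM; congr (_%:~R); lia. Qed.

Lemma zrN a : zr (BinInt.Z.opp a) = - zr a.
Proof. by rewrite /zr -rmorphN; congr (_%:~R); lia. Qed.

Lemma zrB a b : zr (BinInt.Z.sub a b) = zr a - zr b.
Proof. by rewrite /zr -rmorphB; congr (_%:~R); lia. Qed.

Lemma zr_nat n : zr (BinInt.Z.of_nat n) = n%:R.
Proof. by rewrite /zr (_ : int_of_Z _ = n :> int) //; lia. Qed.

Lemma zr_pos c : BinInt.Z.ltb BinNums.Z0 c -> 1 <= zr c.
Proof. by move=> h; rewrite /zr ler1z; lia. Qed.

Fixpoint peval (p : seq BinNums.Z) (x : R) : R :=
  if p is a :: p' then zr a + x * peval p' x else 0.

Lemma peval_add p q x : peval (padd p q) x = peval p x + peval q x.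
Proof.
elim: p q => [|a p IH] [|b q] /=; rewrite ?add0r ?addr0 //.
by rewrite zrD -/(padd p q) IH; ring.
Qed.

Lemma peval_scale c p x : peval (pscale c p) x = zr c * peval p x.
Proof. by elim: p => [|a p IH] /=; rewrite ?mulr0 // zrM IH; ring. Qed.

Lemma peval_mul p q x : peval (pmul p q) x = peval p x * peval q x.
Proof.
elim: p => [|a p IH] /=; rewrite ?mul0r // peval_add peval_scale /= IH.
by rewrite -[zr BinNums.Z0]/(0 : R); ring.
Qed.

Lemma peval_foldr (T : Type) (s : seq T) F x :
  peval (foldr padd [::] [seq F i | i <- s]) x = \sum_(i <- s) peval (F i) x.
Proof. by elim: s => [|i s IH] /=; rewrite ?big_nil // big_cons peval_add IH. Qed.

Lemma peval_krav j p q q' r x :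
  peval (kravP j p q q' r) x = krav j (zr p) (zr q) (zr q') (peval r x).
Proof.
elim: j p q q' r => [|j IH] p q q' r /=; first by rewrite mulr0 addr0.
rewrite peval_add peval_mul !peval_scale !IH !zrB zrN zrM peval_add /= mulr0 addr0.
by rewrite -[zr (BinNums.Zpos _)]/(1 : R) -[zr (BinNums.Zneg _)]/(-1 : R); ring.
Qed.

Lemma peval_ffact k n : (k <= n)%N -> peval (ffactP k) n%:R = (n ^_ k)%:R.
Proof.
elim: k => [|k IH] kn; first by rewrite /= mulr0 addr0.
rewrite ffactnSr natrM natrB ?(ltnW kn) // -IH ?(ltnW kn) // peval_mul /= zrN zr_nat.
by rewrite -[zr (BinNums.Zpos _)]/(1 : R); ring.
Qed.

Lemma peval_zero p x : is_zeroP p -> peval p x = 0.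
Proof.
elim: p => //= a p IH /andP[a0 /IH->]; rewrite mulr0 addr0.
by case: (BinInt.Z.eqb_eq BinNums.Z0 a) => /(_ a0) <-.
Qed.

Lemma peval_cert_sum k p Ds x : (p <= 2 * k)%N ->
  peval (cert_sum k p Ds) x = \sum_(i < k) peval (nth [::] Ds i) x *
    krav (2 * i).+1 p%:R ((2 * k)%:R - p%:R) ((2 * k)%:R - p%:R) (2%:R * x - 2%:R * (2 * k)%:R + p%:R).
Proof.
move=> pk; rewrite /cert_sum.
set q := BinInt.Z.of_nat (2 * k - p); set r := [:: _; _].
have er : peval r x = 2%:R * x - 2%:R * (2 * k)%:R + p%:R.
  rewrite /r /= zrB !zr_nat -[zr (BinNums.Zpos _)]/(2%:R : R) !natrM; ring.
have eq : zr q = (2 * k)%:R - p%:R by rewrite zr_nat natrB.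
rewrite peval_foldr -[X in iota 0 X]subn0 -/(index_iota 0 k) big_mkord.
by apply: eq_bigr => i _; rewrite peval_mul peval_krav er eq zr_nat.
Qed.

(** In Horner form a + n y, once y >= 1 any n > |a| gives a value at least 1; the innermost y is the
    positive leading coefficient. *)
Lemma peval_pos p : BinInt.Z.ltb BinNums.Z0 (last BinNums.Z0 p) ->
  exists N, forall n, (N <= n)%N -> 1 <= peval p n%:R.
Proof.
elim: p => [|a [|b p] IH] //= h.
  by exists 0%N => n _; rewrite mulr0 addr0 zr_pos.
have [N hN] := IH h; exists (maxn N (BinInt.Z.abs_nat a).+1) => n.
rewrite geq_max => /andP[/hN h1 h2]; move: h1; rewrite /=.
move: (zr b + _) => y h1.
have h3 : - zr a + 1 <= n%:R.
  by rewrite /zr -rmorphN -[1]/(1%:~R) -rmorphD -[n%:R]/(n%:~R) ler_int; lia.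
have n0 : (0 : R) <= n%:R by rewrite ler0n.
have : n%:R * 1 <= n%:R * y by rewrite ler_wpM2l.
by rewrite mulr1 => h4; apply: le_trans (lerD (lexx (zr a)) h4); lra.
Qed.

(** For large n the polynomials D and D_i are positive, and dividing the checked identities by D
    gives the linear system. The identity at p = 2k is checked after multiplication by k!, which
    turns 'C(n, k) into a falling factorial with integer coefficients. *)
Lemma kernel_weights k cert : check_cert k cert ->
  exists N, forall n, (N <= n)%N -> exists w : nat -> R,
    (forall i, (i < k)%N -> 0 <= w i) /\
    (forall p, (p <= 2 * k)%N -> ~~ odd p ->
      \sum_(i < k) w i * krav (2 * i).+1 p%:R ((2 * k)%:R - p%:R) ((2 * k)%:R - p%:R)
        ((2 * n)%:R - 2%:R * (2 * k)%:R + p%:R) =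
      ('C(n, k))%:R * (p == 2 * k)%N%:R - 1).
Proof.
case: cert => D Ds /and5P[/eqP sD /peval_pos[N0 hN0] hDs hz hk].
have [N1 hN1] : exists N, forall n, (N <= n)%N -> forall i, (i < k)%N -> 1 <= peval (nth [::] Ds i) n%:R.
  rewrite -sD; elim: Ds {sD hz hk} hDs => [|d Ds IH] /=; first by exists 0%N.
  move=> /andP[/peval_pos[N1 h1] /IH[N2 h2]]; exists (maxn N1 N2) => n.
  by rewrite geq_max => /andP[n1 n2] [|i] ik /=; [exact: h1 | exact: h2].
exists (maxn k (maxn N0 N1)) => n; rewrite !geq_max => /and3P[kn /hN0 D1 /hN1 Ds1].
have D0 : 0 < peval D n%:R by apply: lt_le_trans D1.
exists (fun i => peval (nth [::] Ds i) n%:R / peval D n%:R); split=> [i ik|p pk op].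
  by rewrite divr_ge0 ?(ltW D0) // (le_trans ler01) // Ds1.
transitivity (peval (cert_sum k p Ds) n%:R / peval D n%:R).
  rewrite peval_cert_sum // mulr_suml; apply: eq_bigr => i _.
  by rewrite [(2 * n)%:R]natrM [LHS]mulrAC.
have D0' := gt_eqF D0.
have [pk'|pk'] := eqVneq p (2 * k)%N.
  have := peval_zero n%:R hk; rewrite peval_add !peval_scale peval_mul peval_add zr_nat -pk'.
  rewrite peval_ffact // -bin_ffact natrM mulr1 => h.
  rewrite -[zr (BinNums.Zneg _)]/(-1 : R) in h.
  have k0 : (k`!%:R : R) != 0 by rewrite pnatr_eq0 -lt0n fact_gt0.
  have {}h : peval (cert_sum k p Ds) n%:R = peval D n%:R * ('C(n, k)%:R - 1).
    apply: (mulfI k0); lra.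
  by rewrite h mulrAC divff ?mul1r // D0'.
have [i ei ik] : exists2 i, p = (2 * i)%N & (i < k)%N.
  exists (p./2); [|]; lia.
have /allP/(_ i) := hz; rewrite mem_iota /= add0n ik => /(_ isT) /(peval_zero n%:R).
rewrite peval_add -ei mulr0 sub0r => /eqP; rewrite addr_eq0 => /eqP->.
by rewrite mulNr divff // D0'.
Qed.

Lemma kernel_weights_le5 k : (1 <= k <= 5)%N ->
  exists N, forall n, (N <= n)%N -> exists w : nat -> R,
    (forall i, (i < k)%N -> 0 <= w i) /\
    (forall p, (p <= 2 * k)%N -> ~~ odd p ->
      \sum_(i < k) w i * krav (2 * i).+1 p%:R ((2 * k)%:R - p%:R) ((2 * k)%:R - p%:R)
        ((2 * n)%:R - 2%:R * (2 * k)%:R + p%:R) =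
      ('C(n, k))%:R * (p == 2 * k)%N%:R - 1).
Proof.
case: k => [|[|[|[|[|[|k]]]]]] // _.
- exact: (kernel_weights check_cert1).
- exact: (kernel_weights check_cert2).
- exact: (kernel_weights check_cert3).
- exact: (kernel_weights check_cert4).
- exact: (kernel_weights check_cert5).
Qed.

End CertificateSoundness.

(** * Growth rates and assembly *)

Section Asymptotics.
Variable R : realType.

Lemma sqrtrXn (x : R) k : 0 <= x -> Num.sqrt (x ^+ k) = Num.sqrt x ^+ k.
Proof.
by move=> x0; elim: k => [|k IH]; rewrite ?expr0 ?sqrtr1 // !exprS sqrtrM // IH.
Qed.

(** Every factor of the falling factorial is at least n / 2. *)
Lemma expn_le_ffact n k : (2 * k <= n)%N -> (n ^ k <= 2 ^ k * n ^_ k)%N.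
Proof.
elim: k => [|k IH] kn; first by rewrite !expn0 ffactn0.
have h1 : (n <= 2 * (n - k))%N by lia.
have h2 : (n ^ k <= 2 ^ k * n ^_ k)%N by apply: IH; lia.
rewrite ffactnSr !expnS; apply: leq_trans (leq_mul h1 h2) _.
by rewrite mulnACA [((n - k) * _)%N]mulnC.
Qed.

(** The middle term of Vandermonde's sum gives 'C(2n, 2k) >= 'C(n, k)^2, so the ratio is at most 1 /
    'C(n, k), and 'C(n, k) >= n^k / (2^k k!). *)
Lemma binomial_ratio_le n k : (2 * k <= n)%N -> (1 <= n)%N ->
  ('C(n, k))%:R / ('C(2 * n, 2 * k))%:R <= (2 ^ k * k`!)%:R / n%:R ^+ k :> R.
Proof.
move=> kn n1.
have b0 : (0 < 'C(n, k))%N by rewrite bin_gt0; lia.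
have b2 : ('C(n, k) * 'C(n, k) <= 'C(2 * n, 2 * k))%N.
  rewrite [X in (_ <= 'C(X, _))%N]mul2n -addnn -binomial.Vandermonde.
  have kk : (k < (2 * k).+1)%N by lia.
  rewrite (bigD1 (Ordinal kk)) //= (_ : 2 * k - k = k)%N ?leq_addr //; lia.
have B0 : (0 < 'C(2 * n, 2 * k))%N by apply: leq_trans b2; rewrite muln_gt0 b0.
have h : (n ^ k <= 2 ^ k * k`! * 'C(n, k))%N.
  by rewrite -mulnA [(k`! * _)%N]mulnC bin_ffact expn_le_ffact.
rewrite ler_pdivrMr ?ltr0n // mulrAC ler_pdivlMr ?exprn_gt0 ?ltr0n //.
rewrite -natrX -!natrM ler_nat; apply: leq_trans (leq_mul (leqnn (2 ^ k * k`!)) b2).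
by rewrite mulnA [leqLHS]mulnC leq_mul2r h orbT.
Qed.

Lemma eta_upper k : (1 <= k <= 5)%N -> exists N : nat,
  forall (n : nat) (g : 'I_(2 * n) -> 'M[R[i]]_(2 ^ n)), (N <= n)%N -> is_majorana g ->
  eta_star g (2 * k) <= Num.sqrt (('C(n, k))%:R / ('C(2 * n, 2 * k))%:R).
Proof.
move=> k5; have [N hN] := kernel_weights_le5 R k5.
exists (maxn k N) => n g; rewrite geq_max => /andP[kn /hN[w [w0 hw]]] hg.
have hg' : majorana g := hg.
have C0 : (0 : R) < ('C(2 * n, 2 * k))%:R by rewrite ltr0n bin_gt0; lia.
apply: eta_star_le => eta _ /(jm_bound hg) h.
set t : R := ('C(n, k))%:R; have t0 : 0 <= t by apply: ler0n.
have e : Num.sqrt (t / ('C(2 * n, 2 * k))%:R) * ('C(2 * n, 2 * k))%:R =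
    Num.sqrt (t * ('C(2 * n, 2 * k))%:R).
  rewrite -{2}(ger0_norm (ltW C0)) -sqrtr_sqr -sqrtrM ?divr_ge0 ?(ltW C0) //.
  by congr (Num.sqrt _); field; rewrite gt_eqF.
rewrite -(ler_pM2r C0) e; apply: h => G a pG a1.
have -> := sum_Sm a (fun S => ev G (gset g S)).
apply: (kernel_bound hg' pG (w := w) (J := k)) => //; first by rewrite oddM.
by move=> S; case: insub => [s|]; rewrite ?normr0.
Qed.

Lemma eta_lower_asymp k : (1 <= k)%N -> exists2 c : R, 0 < c &
  forall (n : nat) (g : 'I_(2 * n) -> 'M[R[i]]_(2 ^ n)), (2 ^ (2 * k) <= n)%N -> is_majorana g ->
  c / Num.sqrt (n%:R ^+ k) <= eta_star g (2 * k).
Proof.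
move=> k1; exists ((2 ^ 2 ^ (2 * k).+1)%:R^-1 * (Num.sqrt 2%:R)^-1 ^+ k).
  by rewrite mulr_gt0 ?invr_gt0 ?exprn_gt0 ?invr_gt0 ?sqrtr_gt0 ?ltr0n ?expn_gt0.
move=> n g nk hg; apply: le_trans (eta_lower k1 nk hg).
by rewrite sqrtrXn // natrM sqrtrM // invfM exprMn -mulrA !exprVn.
Qed.

End Asymptotics.

Theorem theorem2 (R : realType) :
  (* (i) *)
  ((forall (n : nat) (g : 'I_(2 * n) -> 'M[R[i]]_(2 ^ n)),
      (1 <= n)%N -> is_majorana g ->
      eta_star g 2 <= 1 / Num.sqrt ((2 * n - 1)%:R : R) /\
      (eta_star g 2 = 1 / Num.sqrt ((2 * n - 1)%:R : R) <->
         exists H : 'M[int]_(2 * n), skew_hadamard H)) /\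
   (exists (c C : R) (N : nat), 0 < c /\ 0 < C /\
      forall (n : nat) (g : 'I_(2 * n) -> 'M[R[i]]_(2 ^ n)),
        (N <= n)%N -> is_majorana g ->
        c / Num.sqrt (n%:R : R) <= eta_star g 2 /\
        eta_star g 2 <= C / Num.sqrt (n%:R : R))) /\
  (* (ii) *)
  (forall k : nat, (1 <= k <= 5)%N ->
    (exists N : nat,
       forall (n : nat) (g : 'I_(2 * n) -> 'M[R[i]]_(2 ^ n)),
         (N <= n)%N -> is_majorana g ->
         eta_star g (2 * k) <=
           Num.sqrt (('C(n, k))%:R / ('C(2 * n, 2 * k))%:R : R)) /\
    (exists (c C : R) (N : nat), 0 < c /\ 0 < C /\
       forall (n : nat) (g : 'I_(2 * n) -> 'M[R[i]]_(2 ^ n)),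
         (N <= n)%N -> is_majorana g ->
         c / Num.sqrt ((n%:R : R) ^+ k) <= eta_star g (2 * k) /\
         eta_star g (2 * k) <= C / Num.sqrt ((n%:R : R) ^+ k))).
Proof.
split; last first.
  move=> k k5; have /andP[k1 _] := k5; have [N hN] := eta_upper R k5; split; first by exists N.
  have [c c0 hc] := eta_lower_asymp R k1.
  (* The upper constant comes from [binomial_ratio_le]; the threshold 2^(2k) is that of the lower
     bound and also ensures 2k <= n. *)
  exists c, (Num.sqrt (2 ^ k * k`!)%:R), (maxn N (2 ^ (2 * k))); split=> //; split.
    by rewrite sqrtr_gt0 ltr0n muln_gt0 expn_gt0 fact_gt0.
  move=> n g; rewrite geq_max => /andP[nN nk] hg; split; first exact: hc.
  apply: le_trans (hN n g nN hg) _.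
  have kn : (2 * k <= n)%N by apply: leq_trans nk; apply: ltnW; apply: ltn_expl.
  have n1 : (1 <= n)%N by apply: leq_trans nk; rewrite expn_gt0.
  have sn : 0 < Num.sqrt (n%:R ^+ k : R) by rewrite sqrtr_gt0 exprn_gt0 // ltr0n.
  rewrite ler_pdivlMr // -sqrtrM ?divr_ge0 //; apply: ler_wsqrtr.
  by rewrite -ler_pdivlMr ?exprn_gt0 ?ltr0n // binomial_ratio_le.
split.
  move=> n g n1 hg; rewrite subn1; split; first exact: eta2_le.
  split=> [e|[H sH]]; last by apply/eqP; rewrite eq_le eta2_le ?(eta2_ge n1 hg sH).
  by apply: boolp.contrapT => noH; have := eta2_lt hg n1 noH; rewrite e ltxx.
have [c c0 hc] := eta_lower_asymp R (leqnn 1).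
(* The upper constant is 1 because n <= 2n - 1; the threshold 4 is 2^(2k) at k = 1. *)
exists c, 1, 4; split=> //; split=> // n g n4 hg; split.
  by have := hc n g n4 hg; rewrite expr1 muln1.
have n1 : (1 <= n)%N by apply: leq_trans n4.
apply: le_trans (eta2_le hg n1) _.
rewrite !div1r lef_pV2 ?posrE ?sqrtr_gt0 ?ltr0n //; last by lia.
by apply: ler_wsqrtr; rewrite ler_nat; lia.
Qed.
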